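(* Let $f \in \mathbb{C}[x_1,\ldots,x_n]_d$ be homogeneous of degree $d$ with $f \trianglelefteq P^{[d]}_{1,1}$. Then either $f \le P^{[d]}_{1,1}$, or $\underline{\mathsf{WR}}(f) = O(d^5)$.
   Context: $P^{[d]}_{1,1} := z_1 z_2\cdots z_d + y^d$, a polynomial in the $d+1$ variables $z_1,\ldots,z_d,y$. For a homogeneous polynomial $f$ in variables $x_1,\ldots,x_n$ and $g$ in variables $w_1,\ldots,w_N$, both of degree $d$: $f\le g$ means $f(x)=g(Ax)$ for some complex $N\times n$ matrix $A$; $f\trianglelefteq g$ means $f$ lies in the closure (Euclidean, equivalently Zariski) of $\{x\mapsto g(Ax) : A\in\mathbb{C}^{N\times n}\}$. The border Waring rank $\underline{\mathsf{WR}}(f)$ is the smallest $r$ with $f=\lim_{\varepsilon\to0}\sum_{i=1}^r \ell_i(\varepsilon)^d$ for linear forms $\ell_i$ with coefficients in $\mathbb{C}(\varepsilon)$. $O(d^5)$ means bounded by $Cd^5$ for an absolute constant $C$. *)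

(* Defs.v *)
From HB Require Import structures.
From mathcomp Require Import all_boot all_order all_algebra.
From mathcomp Require Import complex reals mpoly.

Set Implicit Arguments.
Unset Strict Implicit.
Unset Printing Implicit Defensive.

Import GRing.Theory Num.Theory.

Local Open Scope ring_scope.
Local Open Scope complex_scope.

(* The field of complex numbers is R[i], for R : realType. *)

Section LinearForms.
Variable K : comNzRingType.

Definition linForm (n : nat) (a : 'rV[K]_n) : {mpoly K[n]} :=
  \sum_(j < n) a ord0 j *: 'X_j.

(* x |-> g (A x) *)
Definition linSubst (n N : nat) (A : 'M[K]_(N, n)) (g : {mpoly K[N]}) :
    {mpoly K[n]} :=
  g \mPo [tuple linForm (row i A) | i < N].

(* The variables z_1, ..., z_d are 'X_0, ..., 'X_(d-1), and y is 'X_d. *)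
Definition prodPlusPower (d : nat) : {mpoly K[d.+1]} :=
  \prod_(i < d) 'X_(widen_ord (leqnSn d) i) + 'X_ord_max ^+ d.

(* f <= g *)
Definition isProjection (n N : nat) (f : {mpoly K[n]}) (g : {mpoly K[N]}) :
    Prop :=
  exists A : 'M[K]_(N, n), f = linSubst A g.

End LinearForms.

Arguments prodPlusPower : clear implicits.

Section Border.
Variable R : realType.
Local Notation C := R[i].

(* f lies in the Euclidean closure of {g (A x)}, where the distance between
   polynomials is the largest modulus of a coefficient of their difference.
   When g is homogeneous, all g (A x) lie in one finite-dimensional space of
   forms, on which this norm induces the Euclidean topology. *)
Definition isBorderProjection (n N : nat) (f : {mpoly C[n]})
    (g : {mpoly C[N]}) : Prop :=
  forall e : R, 0 < e ->
    exists A : 'M[C]_(N, n),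
      forall m : 'X_{1..n}, `|(linSubst A g)@_m - f@_m| < e%:C.

(* The value at t of the rational function a, computed on the fraction chosen
   by repr. This fraction need not be reduced, and where its denominator
   vanishes the result is 0, but this happens for finitely many t only, so the
   limit below does not depend on the choice. *)
Definition ratEval (a : {fraction {poly C}}) (t : C) : C :=
  (\n_(repr a)).[t] / (\d_(repr a)).[t].

(* a(t) -> c as t -> 0, t <> 0 *)
Definition ratLim0 (a : {fraction {poly C}}) (c : C) : Prop :=
  forall e : R, 0 < e ->
    exists2 h : R, 0 < h &
      forall t : C, t != 0 -> `|t| < h%:C -> `|ratEval a t - c| < e%:C.

(* f is the limit, coefficient by coefficient, of a sum of r d-th powers of
   linear forms over C(eps); L i j is the coefficient of x_j in l_i. *)
Definition hasBorderWaring (n d : nat) (f : {mpoly C[n]}) (r : nat) : Prop :=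
  exists L : 'M[{fraction {poly C}}]_(r, n),
    forall m : 'X_{1..n},
      ratLim0 (\sum_(i < r) linForm (row i L) ^+ d)@_m f@_m.

Definition isBorderWaringRank (n d : nat) (f : {mpoly C[n]}) (r : nat) :
    Prop :=
  hasBorderWaring d f r /\
  forall s : nat, hasBorderWaring d f s -> (r <= s)%N.

End Border.

(* Main.v *)
(* Let l_1(k) ... l_d(k) + y(k)^d tend to f. If the coefficients of y stay bounded, so
   do the products, and f is again of the form l_1 ... l_d + y^d. Otherwise let x_0 be
   a coordinate on which y has its largest coefficient; normalise the coefficient of
   x_0 to 1, so that l_i = b_i (y' + w_i) with w_i free of x_0. The coefficient of x_0^d
   forces B = b_1 ... b_d to infinity, while B e_j(w) stays bounded for all j > 0. By
   Newton's identities B p_j(w) is then equivalent to (-1)^(j-1) j B e_j(w), hence f is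
   a limit of sums over i of binary forms in (y', w_i), that is of d(d+1) d-th powers.

   It remains to replace a sequence by a curve over C(eps). Being in the closure means
   that the squared distance G, a real polynomial in the real and imaginary parts v of
   the coefficients, has infimum 0. Minimise G + t (v_1^(K+1) + v_2^(K+1) + ...), where
   K + 1 is even and K > deg G. The equations of the critical points have the leading
   forms v_i^K, so every coordinate of t v is integral over C[t], and a Newton-Puiseux
   argument approximates it to any order by a polynomial in a root of t. All limits are
   taken along a nonprincipal ultrafilter, so that no subsequences are needed. *)

Require Import Defs.
From HB Require Import structures.
From mathcomp Require Import all_boot all_order all_algebra.
From mathcomp Require Import complex reals mpoly.
From mathcomp Require Import boolp.
From mathcomp Require classical_sets filter.
From mathcomp Require Import ring lra zify.

Set Implicit Arguments.
Unset Strict Implicit.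
Unset Printing Implicit Defensive.

Import Order.TTheory GRing.Theory Num.Theory.

Local Open Scope ring_scope.

(** * Sequences modulo an ultrafilter *)

(** A curve is needed because border Waring rank asks for linear forms over C(eps), whereas a point
    of the closure only comes with an unstructured sequence of matrices. The penalty does two things
    at once: it makes the minimum attained, and it gives the critical equations pure powers as
    leading forms. Monomials with small exponents then span everything on the solutions, and each
    coordinate of t v is an eigenvalue of a matrix over C[t], however degenerate G is. Finite
    precision suffices in the Newton-Puiseux step: a polynomial of degree less than D, evaluated at
    z/t with z bounded, moves by O(t) when z moves by O(t^D). The approximation is therefore stated
    for approximate roots, so that Hensel lifting can be truncated. In the other direction, a
    polynomial in s whose quotient by s^n converges along one sequence s -> 0 is divisible by s^n;
    this turns a numerical limit into an identity over C(eps). *)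

Record ultrafilter := Ultrafilter {
  largely :> (nat -> Prop) -> Prop;
  largelyS : forall P Q : nat -> Prop,
    (forall k, P k -> Q k) -> largely P -> largely Q;
  largelyI : forall P Q : nat -> Prop,
    largely P -> largely Q -> largely (fun k => P k /\ Q k);
  largely_ex : forall P : nat -> Prop, largely P -> exists k, P k;
  largelyVN : forall P : nat -> Prop, largely P \/ largely (fun k => ~ P k);
  largely_ge : forall N, largely (fun k => (N <= k)%N) }.

Lemma ultrafilter_exists : inhabited ultrafilter.
Proof.
have [G [GU eG]] := filter.ultraFilterLemma filter.eventually_filter.
have GF : filter.Filter G := @filter.filter_filter _ _ (@filter.ultra_proper _ _ GU).
constructor; exists G.
- by move=> P Q PQ; exact: filter.filterS.
- by move=> P Q; exact: filter.filterI.
- move=> P GP; apply: contrapT => nP.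
  apply: (filter.filter_not_empty G); apply: filter.filterS GP => k Pk.
  by apply: nP; exists k.
- by move=> P; exact: filter.in_ultra_setVsetC.
- by move=> N; apply: eG; exists N.
Qed.

Section Largely.
Variable U : ultrafilter.
Implicit Types P Q : nat -> Prop.

Lemma largelyT P : (forall k, P k) -> U P.
Proof. by move=> h; apply: largelyS (largely_ge U 0) => k _. Qed.

Lemma largelyS2 P Q (T : nat -> Prop) :
  (forall k, P k -> Q k -> T k) -> U P -> U Q -> U T.
Proof.
by move=> h uP uQ; apply: largelyS (largelyI uP uQ) => k [? ?]; apply: h.
Qed.

Lemma largely_all_seq (I : eqType) (s : seq I) (P : I -> nat -> Prop) :
  (forall i, i \in s -> U (P i)) -> U (fun k => forall i, i \in s -> P i k).
Proof.
elim: s => [|j s IH] h; first exact: largelyT.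
have uj : U (P j) by apply: h; rewrite mem_head.
have us : U (fun k => forall i, i \in s -> P i k).
  by apply: IH => i ins; apply: h; rewrite inE ins orbT.
apply: largelyS2 uj us => k Pj Ps i; rewrite inE => /orP[/eqP-> //|].
exact: Ps.
Qed.

Lemma largely_all (I : finType) (P : I -> nat -> Prop) :
  (forall i, U (P i)) -> U (fun k => forall i, P i k).
Proof.
move=> h; have := @largely_all_seq _ (enum I) P (fun i _ => h i).
by apply: largelyS => k hk i; apply: hk; rewrite mem_enum.
Qed.

(** The pigeonhole principle of the ultrafilter: it replaces the passage to a subsequence along
    which a choice from a finite set is constant. *)
Lemma largely_exists (I : finType) (P : I -> nat -> Prop) :
  U (fun k => exists i, P i k) -> exists i, U (P i).
Proof.
move=> h; apply: contrapT => nP.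
have : U (fun k => forall i, ~ P i k).
  apply: largely_all => i; have [Pi|//] := largelyVN U (P i).
  by case: nP; exists i.
by move=> /(largelyI h)/largely_ex[k [[i Pik] /(_ i)]].
Qed.

Section Size.
Variable K : numFieldType.
Implicit Types x y z : nat -> K.

Definition bounded x := exists M : K, U (fun k => `|x k| <= M).
Definition vanish x := forall e : K, 0 < e -> U (fun k => `|x k| < e).

Lemma bounded_ae x y : U (fun k => x k = y k) -> bounded x -> bounded y.
Proof.
move=> exy [M hM]; exists M; apply: largelyS2 exy hM => k -> //.
Qed.

Lemma bounded_ext x y : (forall k, x k = y k) -> bounded x -> bounded y.
Proof. by move=> exy; apply: bounded_ae; apply: largelyT. Qed.

Lemma vanish_ae x y : U (fun k => x k = y k) -> vanish x -> vanish y.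
Proof. by move=> exy vx e e0; apply: largelyS2 exy (vx e e0) => k ->. Qed.

Lemma vanish_ext x y : (forall k, x k = y k) -> vanish x -> vanish y.
Proof. by move=> exy; apply: vanish_ae; apply: largelyT. Qed.

Lemma bounded_le x y :
  U (fun k => `|x k| <= `|y k|) -> bounded y -> bounded x.
Proof.
by move=> h [M hM]; exists M; apply: largelyS2 h hM => k; apply: le_trans.
Qed.

Lemma vanish_le x y : U (fun k => `|x k| <= `|y k|) -> vanish y -> vanish x.
Proof.
by move=> h v e e0; apply: largelyS2 h (v e e0) => k; apply: le_lt_trans.
Qed.

Lemma boundedP x : bounded x <-> exists2 M : K, 0 < M & U (fun k => `|x k| < M).
Proof.
split=> [[M hM]|[M _ hM]]; last by exists M; apply: largelyS hM => k /ltW.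
have [k hk] := largely_ex hM; have M0 : 0 <= M by apply: le_trans hk.
exists (M + 1); first by rewrite ltr_wpDl.
by apply: largelyS hM => j /le_lt_trans; apply; rewrite ltrDl.
Qed.

Lemma bounded_cst c : bounded (fun=> c).
Proof. by exists `|c|; apply: largelyT. Qed.

Lemma boundedD x y : bounded x -> bounded y -> bounded (fun k => x k + y k).
Proof.
move=> [M hM] [N hN]; exists (M + N); apply: largelyS2 hM hN => k h1 h2.
by apply: (le_trans (ler_normD _ _)); apply: lerD.
Qed.

Lemma boundedM x y : bounded x -> bounded y -> bounded (fun k => x k * y k).
Proof.
move=> [M hM] [N hN]; exists (M * N); apply: largelyS2 hM hN => k h1 h2.
by rewrite normrM; apply: ler_pM.
Qed.

Lemma boundedN x : bounded x -> bounded (fun k => - x k).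
Proof. by apply: bounded_le; apply: largelyT => k; rewrite normrN. Qed.

Lemma boundedB x y : bounded x -> bounded y -> bounded (fun k => x k - y k).
Proof. by move=> bx /boundedN by_; apply: boundedD. Qed.

Lemma boundedX x n : bounded x -> bounded (fun k => x k ^+ n).
Proof.
move=> bx; elim: n => [|n IH]; first exact: bounded_cst.
by apply: bounded_ext (boundedM bx IH) => k; rewrite exprS.
Qed.

Lemma bounded_sum (I : Type) (s : seq I) (P : pred I) (x : I -> nat -> K) :
  (forall i, P i -> bounded (x i)) ->
  bounded (fun k => \sum_(i <- s | P i) x i k).
Proof.
move=> h; elim: s => [|i s IH].
  by apply: bounded_ext (bounded_cst 0) => k; rewrite big_nil.
case Pi: (P i); last by apply: bounded_ext IH => k; rewrite big_cons Pi.
by apply: bounded_ext (boundedD (h i Pi) IH) => k; rewrite big_cons Pi.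
Qed.

Lemma bounded_prod (I : Type) (s : seq I) (P : pred I) (x : I -> nat -> K) :
  (forall i, P i -> bounded (x i)) ->
  bounded (fun k => \prod_(i <- s | P i) x i k).
Proof.
move=> h; elim: s => [|i s IH].
  by apply: bounded_ext (bounded_cst 1) => k; rewrite big_nil.
case Pi: (P i); last by apply: bounded_ext IH => k; rewrite big_cons Pi.
by apply: bounded_ext (boundedM (h i Pi) IH) => k; rewrite big_cons Pi.
Qed.

Lemma vanish_bounded x : vanish x -> bounded x.
Proof. by move=> /(_ 1 ltr01) h; exists 1; apply: largelyS h => k /ltW. Qed.

Lemma vanish0 : vanish (fun=> 0).
Proof. by move=> e e0; apply: largelyT => k; rewrite normr0. Qed.

Lemma vanishD x y : vanish x -> vanish y -> vanish (fun k => x k + y k).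
Proof.
move=> vx vy e e0; have e2 : 0 < e / 2 by rewrite divr_gt0.
apply: largelyS2 (vx _ e2) (vy _ e2) => k h1 h2.
by rewrite (splitr e); apply: le_lt_trans (ler_normD _ _) _; apply: ltrD.
Qed.

Lemma vanishN x : vanish x -> vanish (fun k => - x k).
Proof. by apply: vanish_le; apply: largelyT => k; rewrite normrN. Qed.

Lemma vanishB x y : vanish x -> vanish y -> vanish (fun k => x k - y k).
Proof. by move=> vx /vanishN vy; apply: vanishD. Qed.

Lemma vanishMr x y : vanish x -> bounded y -> vanish (fun k => x k * y k).
Proof.
move=> vx /boundedP[M M0 hM] e e0; have eM : 0 < e / M by rewrite divr_gt0.
apply: largelyS2 (vx _ eM) hM => k h1 h2; rewrite normrM.
by rewrite -[e](divfK (lt0r_neq0 M0)); apply: ltr_pM.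
Qed.

Lemma vanishMl x y : bounded x -> vanish y -> vanish (fun k => x k * y k).
Proof. by move=> bx vy; apply: vanish_ext (vanishMr vy bx) => k; rewrite mulrC. Qed.

Lemma vanish_sum (I : Type) (s : seq I) (P : pred I) (x : I -> nat -> K) :
  (forall i, P i -> vanish (x i)) ->
  vanish (fun k => \sum_(i <- s | P i) x i k).
Proof.
move=> h; elim: s => [|i s IH].
  by apply: vanish_ext vanish0 => k; rewrite big_nil.
case Pi: (P i); last by apply: vanish_ext IH => k; rewrite big_cons Pi.
by apply: vanish_ext (vanishD (h i Pi) IH) => k; rewrite big_cons Pi.
Qed.

Lemma vanish_cst c : vanish (fun=> c) -> c = 0.
Proof.
move=> h; apply: contrapT => /eqP c0.
have /h/largely_ex[k] : 0 < `|c| by rewrite normr_gt0.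
by rewrite ltxx.
Qed.

Lemma vanish_lim x c d :
  vanish (fun k => x k - c) -> vanish (fun k => x k - d) -> c = d.
Proof.
move=> vc vd; apply/eqP; rewrite -subr_eq0; apply/eqP; apply: vanish_cst.
by apply: vanish_ext (vanishB vd vc) => k; ring.
Qed.

Lemma vanish_lim_bounded x c : vanish (fun k => x k - c) -> bounded x.
Proof.
move=> /vanish_bounded b; apply: bounded_ext (boundedD b (bounded_cst c)) => k.
by rewrite subrK.
Qed.

Lemma vanish_limM x y c d : vanish (fun k => x k - c) ->
  vanish (fun k => y k - d) -> vanish (fun k => x k * y k - c * d).
Proof.
move=> vx vy; have by_ := vanish_lim_bounded vy.
apply: vanish_ext (vanishD (vanishMr vx by_) (vanishMl (bounded_cst c) vy)) => k.
ring.
Qed.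

Lemma vanish_lim_prod (I : Type) (s : seq I) (P : pred I)
    (x : I -> nat -> K) (c : I -> K) :
  (forall i, P i -> vanish (fun k => x i k - c i)) ->
  vanish (fun k => \prod_(i <- s | P i) x i k - \prod_(i <- s | P i) c i).
Proof.
move=> h; elim: s => [|i s IH].
  by apply: vanish_ext vanish0 => k; rewrite !big_nil subrr.
case Pi: (P i); last by apply: vanish_ext IH => k; rewrite !big_cons Pi.
by apply: vanish_ext (vanish_limM (h i Pi) IH) => k; rewrite !big_cons Pi.
Qed.

Lemma vanish_limX x c n : vanish (fun k => x k - c) ->
  vanish (fun k => x k ^+ n - c ^+ n).
Proof.
move=> v; have := @vanish_lim_prod _ (index_enum 'I_n) predT (fun=> x) (fun=> c).
by move=> /(_ (fun _ _ => v)); apply: vanish_ext => k; rewrite !prodr_const card_ord.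
Qed.

(** Along an ultrafilter, failing to be bounded already means tending to infinity; this makes every
    case distinction on boundedness usable. *)
Lemma not_bounded_gt x M : ~ bounded x -> 0 <= M -> U (fun k => M < `|x k|).
Proof.
move=> nb M0; have [|h] := largelyVN U (fun k => M < `|x k|); first by [].
case: nb; exists M; apply: largelyS h => k /negP.
by rewrite -real_leNgt ?ger0_real.
Qed.

Lemma not_bounded_neq0 x : ~ bounded x -> U (fun k => x k != 0).
Proof.
move=> /not_bounded_gt/(_ (lexx 0)); apply: largelyS => k.
by rewrite normr_gt0.
Qed.

Lemma vanish_inv x : ~ bounded x -> vanish (fun k => (x k)^-1).
Proof.
move=> nb e e0; have /ltW ei0 : 0 < e^-1 by rewrite invr_gt0.
apply: largelyS (not_bounded_gt nb ei0) => k h.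
rewrite normfV -[e]invrK ltf_pV2 ?posrE ?invr_gt0 //.
by apply: lt_trans h; rewrite invr_gt0.
Qed.

Lemma bounded_of_pow x n : (0 < n)%N ->
  bounded (fun k => x k ^+ n) -> bounded x.
Proof.
case: n => // n _ b; apply: contrapT => nb; apply: (nb).
apply: bounded_le b; apply: largelyS (not_bounded_gt nb ler01) => k h.
by rewrite normrX exprS ler_peMr // exprn_ege1 // ltW.
Qed.

End Size.

End Largely.

Lemma gt0_Re (R : rcfType) (z : R[i]) : 0 < z -> z = (complex.Re z)%:C%C.
Proof. by case: z => a b; rewrite ltcE /= => /andP[/eqP->]. Qed.

Lemma normc_Re (R : rcfType) (z : R[i]) : `|z| = (complex.Re `|z|)%:C%C.
Proof. by case: z => a b; rewrite normc_def. Qed.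

(* Real and imaginary parts of the limit are obtained as suprema. *)
Section StandardPart.
Variables (R : realType) (U : ultrafilter).

Lemma real_standard_part (x : nat -> R) : bounded U x ->
  exists c, vanish U (fun k => x k - c).
Proof.
case=> M hM; pose E : classical_sets.set R := fun r => U (fun k => r <= x k).
have supE : classical_sets.has_sup E.
  split; first by exists (- M); apply: largelyS hM => k; rewrite ler_norml => /andP[].
  exists M => r Er; have [k []] := largely_ex (largelyI Er hM).
  by rewrite ler_norml => h /andP[_]; apply: le_trans.
exists (reals.sup E) => e e0.
have [r Er hr] := sup_adherent e0 supE.
have nE : ~ E (reals.sup E + e / 2).
  move=> /(ub_le_sup (proj2 supE)); rewrite gerDl leNgt => /negP; apply.
  by rewrite divr_gt0.
have [//|h] := largelyVN U (fun k => reals.sup E + e / 2 <= x k).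
apply: largelyS2 Er h => k h1 /negP; rewrite -ltNge => h2.
by rewrite ltr_norml; apply/andP; split; lra.
Qed.

Lemma standard_part (x : nat -> R[i]) : bounded U x ->
  exists c, vanish U (fun k => x k - c).
Proof.
case=> M hM.
have [j hj] := largely_ex hM; have M0 : 0 <= M by apply: le_trans hj.
have ReM : M = (complex.Re M)%:C%C by move: M0; case: (M) => a b; rewrite lecE /= => /andP[/eqP->].
have norm_part (z : R[i]) : `|complex.Re z|%:C%C <= `|z| /\ `|complex.Im z|%:C%C <= `|z|.
  case: z => a b; rewrite normc_def !lecR /=; split.
    by rewrite -sqrtr_sqr ler_wsqrtr // lerDl sqr_ge0.
  by rewrite -[X in X <= _]sqrtr_sqr ler_wsqrtr // lerDr sqr_ge0.
have bRe : bounded U (fun k => complex.Re (x k)).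
  exists (complex.Re M); apply: largelyS hM => k hk.
  by rewrite -lecR -ReM; apply: le_trans (norm_part _).1 hk.
have bIm : bounded U (fun k => complex.Im (x k)).
  exists (complex.Re M); apply: largelyS hM => k hk.
  by rewrite -lecR -ReM; apply: le_trans (norm_part _).2 hk.
have [a va] := real_standard_part bRe; have [b vb] := real_standard_part bIm.
exists (a +i* b)%C => e e0.
have eR := gt0_Re e0.
have e20 : 0 < complex.Re e / 2.
  by move: e0; rewrite eR ltcR => h; rewrite divr_gt0.
apply: largelyS2 (va _ e20) (vb _ e20) => k h1 h2.
have -> : x k - (a +i* b)%C =
    (complex.Re (x k) - a)%:C%C + 'i%C * (complex.Im (x k) - b)%:C%C.
  by case: (x k) => u v; apply/eqP; rewrite eq_complex /=; apply/andP; split; apply/eqP; ring.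
apply: le_lt_trans (ler_normD _ _) _; rewrite normrM !normc_def /=.
rewrite !expr0n /= !addr0 !sqrtr_sqr expr1n add0r sqrtr1 mul1r -rmorphD.
rewrite [X in _ < X]eR ltcR (splitr (complex.Re e)); exact: ltrD.
Qed.

Lemma vanish_complex (x : nat -> R) :
  vanish U x -> vanish U (fun k => (x k)%:C%C).
Proof.
move=> vx e e0.
have eR := gt0_Re e0.
have e0' : 0 < complex.Re e by move: e0; rewrite eR ltcR.
apply: largelyS (vx _ e0') => k hk.
by rewrite normc_def /= expr0n addr0 sqrtr_sqr eR ltcR.
Qed.

Lemma vanish_harmonic : vanish U (fun k => k.+1%:R^-1 : R).
Proof.
move=> e e0; pose N := Num.bound e^-1.
have hN : e^-1 < N%:R by apply: archi_boundP; rewrite invr_ge0 ltW.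
apply: largelyS (largely_ge U N) => k Nk.
rewrite ger0_norm ?invr_ge0 ?ler0n // -[e]invrK ltf_pV2 ?posrE ?invr_gt0 ?ltr0n //.
by apply: lt_le_trans hN _; rewrite ler_nat ltnW.
Qed.

End StandardPart.

(** * Approximate Newton-Puiseux *)

Section BivariateHensel.
Variable K : fieldType.
Implicit Types (p q r s : {poly K}) (P Q : {poly {poly K}}).

(** In [{poly {poly K}}] the outer variable is the unknown x and the inner one the parameter t;
    [red0] is the reduction at t = 0. *)
Definition red0 P : {poly K} := map_poly (horner_eval 0) P.

Lemma red0_coef P i : (red0 P)`_i = (P`_i).[0].
Proof. by rewrite coef_map. Qed.

Lemma red0_lift p : red0 p^:P = p.
Proof. by apply/polyP => i; rewrite red0_coef coef_map /= hornerC. Qed.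

Lemma poly_divXn n p : (forall i, (i < n)%N -> p`_i = 0) ->
  p = drop_poly n p * 'X^n.
Proof.
move=> h; rewrite -{1}(poly_take_drop n p) (_ : take_poly n p = 0) ?add0r //.
by apply/polyP => i; rewrite coef_take_poly coef0; case: ifP => // /h.
Qed.

Lemma horner_sub0 p x :
  p.[x] - p.[0] = x * \sum_(i < size p) (drop_poly 1 p)`_i * x ^+ i.
Proof.
rewrite -[X in X.[x] - _](poly_take_drop 1 p) hornerD hornerM hornerXn expr1.
rewrite horner_poly big_ord1 expr0 mulr1 -horner_coef0.
rewrite (@horner_coef_wide _ (size p) (drop_poly 1 p)) ?size_drop_poly ?leq_subr //.
by ring.
Qed.

Lemma red0_eq0 P : red0 P = 0 -> exists Q, P = ('X)%:P * Q.
Proof.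
move=> P0; exists (map_poly (drop_poly 1) P); apply/polyP => i.
rewrite coefCM coef_map_id0; last by rewrite raddf0.
rewrite mulrC -['X]expr1; apply: poly_divXn => -[|//] _.
by rewrite -horner_coef0 -red0_coef P0 coef0.
Qed.

Lemma size_sub_monic (A : nzRingType) (p q : {poly A}) n :
  p \is monic -> q \is monic -> size p = n.+1 -> size q = n.+1 ->
  (size (p - q)%R <= n)%N.
Proof.
move=> /monicP mp /monicP mq sp sq; apply/leq_sizeP => j nj.
rewrite coefB; move: nj; rewrite leq_eqVlt => /orP[/eqP<-|nj].
  by move: mp mq; rewrite /lead_coef sp sq /= => -> ->; rewrite subrr.
by rewrite !nth_default ?subrr // ?sp ?sq.
Qed.

(** Multiply a Bezout relation by [p] and reduce the cofactor of [s] modulo [r]; the degree of b r =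
    p - a s then bounds that of b. These size bounds keep the factors monic during Hensel
    lifting. *)
Lemma bezout_small r s p : r \is monic -> s \is monic -> coprimep r s ->
  (size p < (size r + size s).-1)%N ->
  exists a b, [/\ p = a * s + b * r, (size a < size r)%N & (size b < size s)%N].
Proof.
move=> mr ms cop sp; have r0 := monic_neq0 mr; have s0 := monic_neq0 ms.
have [[u v] /= uv] := Bezout_eq1_coprimepP _ _ cop.
pose a := (p * v) %% r; pose b := p * u + (p * v) %/ r * s.
have eab : p = a * s + b * r.
  rewrite -{1}[p]mulr1 -uv mulrDr !mulrA {1}(divp_eq (p * v) r) /a /b.
  ring.
have sa : (size a < size r)%N by rewrite ltn_modp.
exists a, b; split=> //.
have [->|b0] := eqVneq b 0; first by rewrite size_poly0 size_poly_gt0.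
move: (size_poly_gt0 r) (size_poly_gt0 s) (size_poly_gt0 b).
rewrite r0 s0 b0 => r1 s1 b1.
have : (size (b * r)%R < (size r + size s).-1)%N.
  have -> : b * r = p - a * s by rewrite {1}eab; ring.
  apply: leq_ltn_trans (size_polyD _ _) _; rewrite size_polyN gtn_max sp /=.
  have [->|a0] := eqVneq a 0.
    by rewrite mul0r size_poly0; apply: leq_ltn_trans sp.
  move: (size_poly_gt0 a) sa; rewrite size_mul // a0.
  by move: (size a) (size r) (size s) r1 s1 => x y z; lia.
rewrite size_mul //.
by move: (size b) (size r) (size s) r1 s1 b1 => x y z; lia.
Qed.

(** Linear lifting: the error E at order N+1 is corrected by t^(N+1) a and t^(N+1) b with a s + b r
    = E at t = 0. The remainder is kept as an explicit multiple of a power of t, without passing to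
    power series, because the factors will be evaluated at numbers. *)
Lemma hensel P r s : P \is monic -> r \is monic -> s \is monic ->
  coprimep r s -> size P = (size r + size s).-1 -> red0 P = r * s ->
  forall N, exists R S E : {poly {poly K}},
    [/\ P = R * S + ('X^(N.+1))%:P * E, R \is monic /\ S \is monic,
        size R = size r, size S = size s & red0 R = r /\ red0 S = s].
Proof.
move=> mP mr ms cop sP redP.
have r0 := monic_neq0 mr; have s0 := monic_neq0 ms.
have ss : (0 < size s)%N by rewrite size_poly_gt0.
have sr : (0 < size r)%N by rewrite size_poly_gt0.
have sL p : size p^:P = size p by rewrite size_map_polyC.
have addL (Q : {poly {poly K}}) q n : Q \is monic -> (size q < size Q)%N ->
    Q + ('X^n)%:P * q^:P \is monic /\ size (Q + ('X^n)%:P * q^:P) = size Q.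
  move=> mQ sq; have sq' : (size (('X^n)%:P * q^:P)%R < size Q)%N.
    by rewrite size_Cmul ?sL // expf_neq0 // polyX_eq0.
  by rewrite monicE lead_coefDl // size_polyDl // (monicP mQ).
elim=> [|N [R [S [E [eP [mR mS] sR sS [redR redS]]]]]].
  have [|E eE] := @red0_eq0 (P - r^:P * s^:P).
    by rewrite /red0 rmorphB rmorphM /= -!/(red0 _) !red0_lift redP subrr.
  exists r^:P, s^:P, E; rewrite expr1 -eE !sL !red0_lift; split=> //.
    by rewrite addrC subrK.
  by rewrite !monicE !lead_coef_map_inj ?rmorph0 ?(monicP mr) ?(monicP ms) ?rmorph1 //;
    exact: polyC_inj.
have Xn0 : 'X^(N.+1) != 0 :> {poly K} by rewrite expf_neq0 // polyX_eq0.
(* P and R S are monic of the same degree, so their leading terms cancel and the error has smaller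
   degree. *)
have sE : (size E < (size r + size s).-1)%N.
  rewrite -(size_Cmul _ Xn0).
  have -> : ('X^(N.+1))%:P * E = P - R * S by rewrite eP; ring.
  have sRS : size (R * S) = (size r + size s).-1 by rewrite size_monicM ?monic_neq0 // sR sS.
  move: sRS sP; case: (size r + size s)%N (leq_add sr ss) => [|[|n]] //= _ sRS sP.
  by rewrite ltnS; apply: size_sub_monic; rewrite // rpredM.
have [|a [b [eab sa sb]]] := @bezout_small r s (red0 E) mr ms cop.
  by apply: leq_ltn_trans sE; rewrite size_poly.
have [mR' sR'] := addL R a N.+1 mR ltac:(by rewrite sR).
have [mS' sS'] := addL S b N.+1 mS ltac:(by rewrite sS).
have redX n (Q : {poly {poly K}}) : red0 (('X^(n.+1))%:P * Q) = 0.
  by rewrite /red0 rmorphM /= map_polyC /= /horner_eval hornerXn expr0n mul0r.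
have [|E' eE'] := @red0_eq0 (E - a^:P * S - b^:P * R - ('X^(N.+1))%:P * (a^:P * b^:P)).
  rewrite /red0 !rmorphB !(rmorphM (map_poly _) a^:P) /= !(rmorphM (map_poly _) b^:P) /=.
  by rewrite -!/(red0 _) redX !red0_lift redR redS eab; ring.
exists (R + ('X^(N.+1))%:P * a^:P), (S + ('X^(N.+1))%:P * b^:P), E'; split=> //.
- have -> : ('X^(N.+2))%:P * E' = ('X^(N.+1))%:P * ('X%:P * E').
    by rewrite (exprSr 'X N.+1) polyCM mulrA.
  by rewrite -eE' {1}eP; ring.
- by rewrite sR'.
- by rewrite sS'.
by rewrite /red0 !rmorphD /= -!/(red0 _) !redX redR redS !addr0.
Qed.

End BivariateHensel.

Lemma coef_exp_XaddC (A : comNzRingType) (c : A) m :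
  (('X + c%:P) ^+ m.+1)`_m = c *+ m.+1.
Proof.
elim: m => [|m IH].
  by rewrite expr1 coefD coefX coefC add0r.
rewrite exprS mulrDl coefD coefXM coefCM /= IH.
have /monicP : ('X + c%:P) ^+ m.+1 \is monic.
  by rewrite monic_exp // -[c]opprK polyCN monicXsubC.
have -> : lead_coef (('X + c%:P) ^+ m.+1) = (('X + c%:P) ^+ m.+1)`_m.+1.
  by rewrite /lead_coef -[in size _](opprK c) polyCN size_exp_XsubC.
by move=> ->; rewrite mulr1 [RHS]mulrS addrC.
Qed.

Lemma monic_comp_XaddC (A : idomainType) (P : {poly A}) c m :
  P \is monic -> size P = m.+2 ->
  [/\ P \Po ('X + c%:P) \is monic, size (P \Po ('X + c%:P)) = m.+2 &
      (P \Po ('X + c%:P))`_m = P`_m + c *+ m.+1].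
Proof.
move=> mP sP.
have sX i : size (('X + c%:P) ^+ i) = i.+1 by rewrite -[c]opprK polyCN size_exp_XsubC.
have mX i : (('X + c%:P) ^+ i)`_i = 1.
  have /monicP : ('X + c%:P) ^+ i \is monic.
    by rewrite monic_exp // -[c]opprK polyCN monicXsubC.
  by rewrite /lead_coef sX.
split.
- rewrite monicE lead_coef_comp ?(monicP mP) ?mul1r; last by rewrite size_XaddC.
  by rewrite -[c]opprK polyCN lead_coefXsubC expr1n.
- by rewrite size_comp_poly2 // size_XaddC.
rewrite coef_comp_poly sP !big_ord_recr /= big1 => [|i _]; last first.
  by rewrite [X in _ * X]nth_default ?mulr0 // sX.
rewrite add0r mX mulr1 coef_exp_XaddC.
by move: (monicP mP); rewrite /lead_coef sP /= => ->; rewrite mul1r.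
Qed.

(** Split off the full power of X - a for some root a. If the cofactor were constant, p would be (X
    - a)^(m+1), whose coefficient below the leading one is -(m+1) a; in characteristic 0 this gives
    a = 0, the excluded case. *)
Lemma monic_split (K : numClosedFieldType) (p : {poly K}) m :
  p \is monic -> size p = m.+2 -> p`_m = 0 ->
  p <> 'X^(m.+1) -> exists r s : {poly K},
    [/\ r \is monic /\ s \is monic, p = r * s, coprimep r s,
        (1 < size r)%N & (1 < size s)%N].
Proof.
move=> mp sp pm pX.
have [a ra] : exists a, root p a by apply/closed_rootP; rewrite sp.
have [k [q nq pE]] := multiplicity_XsubC p a.
have {}nq : ~~ root q a by move: nq; rewrite monic_neq0.
have mX : ('X - a%:P) ^+ k \is monic by rewrite monic_exp ?monicXsubC.
have mq : q \is monic by move: mp; rewrite pE monicMr.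
have k0 : (0 < k)%N.
  by case: k pE {mX} => // pE; move: nq ra; rewrite pE expr0 mulr1 => /negPf->.
exists (('X - a%:P) ^+ k), q; split=> //.
- by rewrite mulrC.
- by apply: coprimep_expl; rewrite coprimep_sym coprimep_XsubC.
- by rewrite size_exp_XsubC.
have : (0 < size q)%N by rewrite size_poly_gt0 monic_neq0.
rewrite leq_eqVlt => /orP[/eqP/esym/eqP/size_poly1P[c c0 qc]|//].
have c1 : c = 1 by move: mq; rewrite qc monicE lead_coefC => /eqP.
move: pE; rewrite qc c1 mul1r => pE.
have km : k = m.+1 by move: sp; rewrite pE size_exp_XsubC => -[].
move: pm; rewrite pE km -polyCN coef_exp_XaddC => /eqP.
rewrite -mulr_natr mulf_eq0 oppr_eq0 => /orP[/eqP a0|].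
  by case: pX; rewrite pE km a0 subr0.
by rewrite pnatr_eq0.
Qed.

(** * Approximation of roots by polynomials in a root of the parameter *)

Section Puiseux.
Variables (U : ultrafilter) (C : numClosedFieldType).
Implicit Types (P : {poly {poly C}}) (t x z : nat -> C).

Lemma bounded_horner (p : {poly C}) x :
  bounded U x -> bounded U (fun k => p.[x k]).
Proof.
move=> bx; apply: (@bounded_ext _ _ (fun k => \sum_(i < size p) p`_i * x k ^+ i)).
  by move=> k; rewrite horner_coef.
by apply: bounded_sum => i _; apply: boundedM (bounded_cst _ _) (boundedX _ _).
Qed.

Lemma horner2E P (z t : C) : P.[z%:P].[t] = \sum_(i < size P) (P`_i).[t] * z ^+ i.
Proof.
rewrite [P.[_]]horner_coef horner_sum; apply: eq_bigr => i _.
by rewrite hornerM -polyC_exp hornerC.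
Qed.

Lemma horner2_eval P (q : {poly C}) (t : C) : P.[q].[t] = P.[(q.[t])%:P].[t].
Proof.
rewrite horner2E [P.[_]]horner_coef horner_sum; apply: eq_bigr => i _.
by rewrite hornerM horner_exp.
Qed.

Lemma bounded_horner2 P t z : bounded U t -> bounded U z ->
  bounded U (fun k => P.[(z k)%:P].[t k]).
Proof.
move=> bt bz; apply: (bounded_ext (fun k => esym (horner2E P (z k) (t k)))).
apply: bounded_sum => i _.
by apply: boundedM (bounded_horner _ bt) (boundedX _ bz).
Qed.

(* Otherwise 1/z vanishes, and dividing P(z) by z^(m+1) gives 1 in the limit. *)
Lemma bounded_root P t z m : P \is monic -> size P = m.+2 -> bounded U t ->
  bounded U (fun k => P.[(z k)%:P].[t k]) -> bounded U z.
Proof.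
move=> mP sP bt bP; apply: contrapT => nb.
have vz := vanish_inv nb; have z0 := not_bounded_neq0 nb.
have vzS n : vanish U (fun k => (z k)^-1 ^+ n.+1).
  apply: (vanish_ext (fun k => esym (exprS (z k)^-1 n))).
  exact: vanishMr vz (boundedX _ (vanish_bounded vz)).
pose rest k := \sum_(i < m.+1) (P`_i).[t k] * (z k)^-1 ^+ (m - i).+1.
have v1 : vanish U (fun k => P.[(z k)%:P].[t k] * (z k)^-1 ^+ m.+1 - rest k).
  apply: vanishB; first by apply: vanishMl bP _.
  by apply: vanish_sum => i _; apply: vanishMl (bounded_horner _ bt) _.
suff /vanish_cst/eqP : vanish U (fun=> 1 : C) by rewrite oner_eq0.
apply: vanish_ae v1; apply: largelyS z0 => k z0.
rewrite horner2E sP big_ord_recr /= mulrDl.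
move: (monicP mP); rewrite /lead_coef sP /= => ->.
rewrite hornerC mul1r -exprMn mulfV // expr1n addrAC -[RHS]add0r; congr (_ + _).
apply/eqP; rewrite subr_eq0 /rest mulr_suml; apply/eqP; apply: eq_bigr => i _.
rewrite -mulrA; congr (_ * _).
have -> : (z k)^-1 ^+ m.+1 = (z k)^-1 ^+ i * (z k)^-1 ^+ (m - i).+1.
  by rewrite -exprD; congr (_ ^+ _); have := ltn_ord i; lia.
by rewrite mulrA -exprMn mulfV // expr1n mul1r.
Qed.

(** This decides which factor of a factorisation a sequence of approximate roots belongs to: if [z]
    is unbounded, then |z| > 1 largely, and [x] is dominated by the product. *)
Lemma bounded_mulVP x z : bounded U (fun k => x k * z k) ->
  bounded U x \/ bounded U z.
Proof.
move=> b; have [|nz] := pselect (bounded U z); first by right.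
left; apply: bounded_le b; apply: largelyS (not_bounded_gt nz ler01) => k h.
by rewrite normrM ler_peMr // ltW.
Qed.

(** All exponents of p(X^(d e)) are multiples of d, and there is none strictly between a d and (a+1)
    d. *)
Lemma coef_comp_Xn_gap (p : {poly C}) a d e : (0 < d)%N -> (0 < e)%N ->
  (forall i, (i < (a * d).+1)%N -> (p \Po 'X^(d * e))`_i = 0) ->
  forall i, (i < a.+1 * d)%N -> (p \Po 'X^(d * e))`_i = 0.
Proof.
move=> d0 e0 h i id; have [/h //|] := ltnP i (a * d).+1 => ai.
rewrite coef_comp_poly_Xn ?muln_gt0 ?d0 //; case: ifP => // /dvdnP[j ij].
move: id ai; rewrite ij mulnCA mulnC !(mulnC _ d) !ltn_pmul2l //; nia.
Qed.

(* With t = tau^((m+1)!) every slope of the Newton polygon becomes an integer;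
   theta is the smallest of them, unless it exceeds the required precision. *)
Lemma newton_rescale P m T : P \is monic -> size P = m.+2 ->
  exists theta P',
    [/\ (theta <= T * m.+1`!)%N, P' \is monic /\ size P' = m.+2,
        forall z t : C, P'.[z%:P].[t] * t ^+ (theta * m.+1) =
          P.[(t ^+ theta * z)%:P].[t ^+ m.+1`!],
        P`_m = 0 -> P'`_m = 0 &
        theta = (T * m.+1`!)%N \/ exists2 l, (l < m.+1)%N & (P'`_l).[0] != 0].
Proof.
move=> mP sP; set M := m.+1`!; have M0 : (0 < M)%N by rewrite fact_gt0.
have PL : P`_m.+1 = 1 by move: (monicP mP); rewrite /lead_coef sP.
(* [D th] expresses that substituting x = tau^th z makes P divisible by tau^(th (m+1)), that is,
   that the line of slope th lies below the Newton polygon. *)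
pose D th := [forall l : 'I_m.+1, forall i : 'I_(th * (m.+1 - l)),
  (P`_l \Po 'X^M)`_i == 0].
have DP th : reflect (forall l, (l < m.+1)%N -> forall i,
    (i < th * (m.+1 - l))%N -> (P`_l \Po 'X^M)`_i = 0) (D th).
  apply: (iffP forallP) => [h l lm i ilt|h l].
    by have /forallP/(_ (Ordinal ilt))/eqP := h (Ordinal lm).
  by apply/forallP => i; apply/eqP; apply: h.
have [||th /andP[/DP Dth thT] thmax] :=
    @ex_maxnP (fun th => D th && (th <= T * M)%N) (T * M)%N.
- by exists 0%N; rewrite leq0n andbT; apply/DP => l lm i; rewrite mul0n.
- by move=> i /andP[].
pose P' := \poly_(l < m.+2) drop_poly (th * (m.+1 - l)) (P`_l \Po 'X^M).
have P'E l : (l < m.+2)%N ->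
    P'`_l = drop_poly (th * (m.+1 - l)) (P`_l \Po 'X^M).
  by move=> lm; rewrite coef_poly lm.
have P'L : P'`_m.+1 = 1 by rewrite P'E // subnn muln0 drop_poly0l PL comp_polyC.
have sP' : size P' = m.+2 by rewrite size_poly_eq //= -P'E // P'L oner_neq0.
have dropE l : (l < m.+2)%N ->
    P`_l \Po 'X^M = P'`_l * 'X^(th * (m.+1 - l)).
  move=> lm; rewrite P'E //; apply: poly_divXn => i.
  move: lm; rewrite ltnS leq_eqVlt => /orP[/eqP->|lm]; last exact: Dth.
  by rewrite subnn muln0.
exists th, P'; split=> //.
- by split=> //; rewrite monicE /lead_coef sP' P'L.
- move=> z t; rewrite !horner2E sP sP' mulr_suml; apply: eq_bigr => i _.
  have := congr1 (horner^~ t) (dropE i (ltn_ord i)).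
  rewrite horner_comp !hornerE => ->; rewrite exprMn -exprM.
  have -> : t ^+ (th * m.+1) = t ^+ (th * (m.+1 - i)) * t ^+ (th * i).
    by rewrite -exprD -mulnDr subnK // -ltnS.
  ring.
- by move=> Pm; rewrite P'E // Pm comp_poly0 raddf0.
move: thT; rewrite leq_eqVlt => /orP[/eqP|thT]; [by left|right].
apply: contrapT => nl.
(* If every lower coefficient of P' vanished at tau = 0, the slope could be raised by 1: since m+1-l
   divides (m+1)!, one more vanishing coefficient yields m+1-l of them. *)
suff : D th.+1 by move=> h; have := thmax th.+1; rewrite h thT ltnn => /(_ isT).
apply/DP => l lm.
have [e Me] : exists e, M = ((m.+1 - l) * e)%N.
  have /dvdnP[e ->] : (m.+1 - l %| M)%N by rewrite dvdn_fact // subn_gt0 lm leq_subr.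
  by exists e; rewrite mulnC.
have e0 : (0 < e)%N by move: M0; rewrite Me muln_gt0 => /andP[].
rewrite Me; apply: coef_comp_Xn_gap => //; first by rewrite subn_gt0.
rewrite -Me => i; rewrite ltnS leq_eqVlt => /orP[/eqP->|]; last exact: Dth.
apply: contrapT => /eqP h; apply: nl; exists l => //.
by rewrite horner_coef0 P'E ?coef_drop_poly ?add0n // ltnW.
Qed.

(** Substitute x = tau^theta z. If theta has reached T (m+1)!, then x = O(t^T) and b = 0 will do.
    Otherwise P' at tau = 0 has some nonzero lower coefficient while the one directly below the
    leading one is zero, so it splits into coprime factors of smaller degree; the splitting lifts,
    and z is an approximate root of one lifted factor. *)
Lemma puiseux_depressed m : (forall m', (m' < m)%N ->
    forall P T t x, P \is monic -> size P = m'.+2 -> (forall k, 0 < t k) ->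
    bounded U t ->
    bounded U (fun k => P.[(x k)%:P].[t k] / t k ^+ (m'.+1 * T)) ->
    exists q b, (0 < q)%N /\
      forall s : nat -> C, (forall k, 0 < s k) -> (forall k, s k ^+ q = t k) ->
      bounded U (fun k => (x k - b.[s k]) / t k ^+ T)) ->
  forall P T t x, P \is monic -> size P = m.+2 -> P`_m = 0 ->
    (forall k, 0 < t k) -> bounded U t ->
    bounded U (fun k => P.[(x k)%:P].[t k] / t k ^+ (m.+1 * T)) ->
    exists q b, (0 < q)%N /\
      forall s : nat -> C, (forall k, 0 < s k) -> (forall k, s k ^+ q = t k) ->
      bounded U (fun k => (x k - b.[s k]) / t k ^+ T).
Proof.
move=> IH P T t x mP sP Pm t0 bt bP; set M := m.+1`!.
have addSS a b c : (a.+2 + b.+2 = c.+3 -> [/\ a.+1 + b.+1 = c.+1, a < c & b < c])%N.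
  by clear=> h; split; lia.
have M0 : (0 < M)%N by rewrite fact_gt0.
have [th [P' [thT [mP' sP'] P'E P'm P'l]]] := newton_rescale T mP sP.
pose tau k := M.-root (t k).
have tauM k : tau k ^+ M = t k by rewrite rootCK.
have tau0 k : 0 < tau k by rewrite rootC_gt0.
have tauN k n : tau k ^+ n != 0 by rewrite expf_neq0 // gt_eqF.
have btau : bounded U tau.
  by apply: (bounded_of_pow M0); apply: bounded_ext bt => k; rewrite tauM.
pose z k := x k / tau k ^+ th.
have zx k : tau k ^+ th * z k = x k by rewrite /z mulrC divfK.
(* The precision still required of z, in powers of tau, once tau^theta is split off. *)
pose T' := (T * M - th)%N.
have P'b : bounded U (fun k => P'.[(z k)%:P].[tau k] / tau k ^+ (m.+1 * T')).
  apply: bounded_ext bP => k; rewrite -(zx k) -{1}(tauM k) -P'E.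
  have -> : t k ^+ (m.+1 * T) = tau k ^+ (th * m.+1) * tau k ^+ (m.+1 * T').
    rewrite -(tauM k) -exprM -exprD; congr (_ ^+ _).
    by rewrite (mulnC th) -mulnDr /T' subnKC // mulnCA (mulnC M).
  by field; rewrite !tauN.
have bz : bounded U z.
  apply: (bounded_root mP' sP' btau).
  apply: bounded_ext (boundedM P'b (boundedX (m.+1 * T') btau)) => k.
  by rewrite divfK.
have TE k : t k ^+ T = tau k ^+ th * tau k ^+ T'.
  by rewrite -(tauM k) -exprM -exprD /T' subnKC // mulnC.
case: P'l => [thE|[l lm P'l0]].
  exists 1%N, 0; split=> // s s0 st; apply: bounded_ext bz => k.
  by rewrite horner0 subr0 /z thE -(tauM k) -exprM mulnC.
have mred : red0 P' \is monic by rewrite monic_map.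
have sred : size (red0 P') = m.+2.
  by rewrite size_map_poly_id0 // (monicP mP') /horner_eval hornerC oner_neq0.
have redm : (red0 P')`_m = 0 by rewrite red0_coef P'm // horner0.
have redX : red0 P' <> 'X^(m.+1).
  move=> h; move: P'l0; rewrite -red0_coef h coefXn.
  by rewrite (_ : (l == m.+1) = false) ?eqxx //; apply/negbTE; rewrite neq_ltn lm.
have [r [s [[mr ms] rs cop sr ss]]] := monic_split mred sred redm redX.
have srs : (size r + size s = m.+3)%N.
  have := sred; rewrite rs size_monicM ?monic_neq0 //.
  by move: (size r) sr => [|a] //= _; rewrite addSn /= => ->.
(* At this order the lifting error, divided by tau^((m+1) T'), is tau E(z), which is bounded. *)
have [|R [S [E [PE [mR mS] sR sS _]]]] := @hensel C P' r s mP' mr ms cop _ rs (m.+1 * T')%N.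
  by rewrite srs sP'.
have [m1 m1E] : exists m1, size r = m1.+2.
  by move: (size r) sr => [|[|a]] // _; exists a.
have [m2 m2E] : exists m2, size s = m2.+2.
  by move: (size s) ss => [|[|a]] // _; exists a.
have [mm m1m m2m] := addSS m1 m2 m ltac:(by rewrite -m1E -m2E).
have bRS : bounded U (fun k => (R.[(z k)%:P].[tau k] / tau k ^+ (m1.+1 * T')) *
     (S.[(z k)%:P].[tau k] / tau k ^+ (m2.+1 * T'))).
  have bE := boundedM btau (bounded_horner2 E btau bz).
  apply: bounded_ext (boundedB P'b bE) => k.
  have -> : P'.[(z k)%:P].[tau k] = R.[(z k)%:P].[tau k] * S.[(z k)%:P].[tau k]
      + tau k ^+ (m.+1 * T') * tau k * E.[(z k)%:P].[tau k].
    by rewrite PE !hornerE -exprSr.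
  have -> : tau k ^+ (m.+1 * T') = tau k ^+ (m1.+1 * T') * tau k ^+ (m2.+1 * T').
    by rewrite -exprD -mulnDl mm.
  by field; rewrite !tauN.
have fin m' (Q : {poly {poly C}}) : (m' < m)%N -> Q \is monic -> size Q = m'.+2 ->
    bounded U (fun k => Q.[(z k)%:P].[tau k] / tau k ^+ (m'.+1 * T')) ->
    exists q b, (0 < q)%N /\
      forall s : nat -> C, (forall k, 0 < s k) -> (forall k, s k ^+ q = t k) ->
      bounded U (fun k => (x k - b.[s k]) / t k ^+ T).
  move=> mm' mQ sQ bQ; have [q [b [q0 hb]]] := IH m' mm' Q T' tau z mQ sQ tau0 btau bQ.
  (* If s^(q M) = t with s positive, then s^q = tau; so the factor s^(q theta) is tau^theta, and it
     undoes x = tau^theta z. *)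
  exists (q * M)%N, ('X^(q * th) * b); split; first by rewrite muln_gt0 q0.
  move=> sg sg0 sgE.
  have sgq k : sg k ^+ q = tau k.
    by rewrite /tau -(sgE k) exprM exprCK // exprn_ge0 // ltW.
  apply: bounded_ext (hb sg sg0 sgq) => k.
  rewrite !hornerE exprM sgq TE -(zx k); field.
  by rewrite !tauN.
have [bR|bS] := bounded_mulVP bRS.
  by apply: (fin m1 R) => //; rewrite sR.
by apply: (fin m2 S) => //; rewrite sS.
Qed.

(** The precision (m+1) T is what P = X^(m+1) demands for x = O(t^T), and it is additive in the
    degree, so it distributes over the factors of P. Any positive q-th root [s] is allowed, so that
    several approximations can later share one root. *)
Theorem puiseux_approx m P T t x : P \is monic -> size P = m.+2 ->
  (forall k, 0 < t k) -> bounded U t ->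
  bounded U (fun k => P.[(x k)%:P].[t k] / t k ^+ (m.+1 * T)) ->
  exists q b, (0 < q)%N /\
    forall s : nat -> C, (forall k, 0 < s k) -> (forall k, s k ^+ q = t k) ->
    bounded U (fun k => (x k - b.[s k]) / t k ^+ T).
Proof.
elim/ltn_ind: m P T t x => m IH P T t x mP sP t0 bt bP.
(* Tschirnhaus shift: P(x + c) has no coefficient directly below the leading one. *)
pose c : {poly C} := - (m.+1%:R^-1 *: P`_m).
have [mP1 sP1 P1m] := monic_comp_XaddC c mP sP.
have [||q [b [q0 hb]]] := puiseux_depressed IH (T := T) (t := t)
    (x := fun k => x k - c.[t k]) mP1 sP1 _ t0 bt.
- rewrite P1m /c mulNrn -scaler_nat scalerA mulfV ?pnatr_eq0 // scale1r.
  by rewrite subrr.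
- apply: bounded_ext bP => k; congr (_ / _).
  rewrite horner_comp [in RHS]horner2_eval horner2_eval !hornerE.
  by congr (_.[_%:P].[_]); ring.
exists q, (b + (c \Po 'X^q)); split=> // s s0 st.
apply: bounded_ext (hb s s0 st) => k; rewrite hornerD horner_comp hornerXn st.
by congr (_ / _); ring.
Qed.

End Puiseux.

(** * Integrality of the solutions of a system with leading forms x_j^D *)

Section Elimination.
Variables (K : fieldType) (M D : nat).
Variables (supp : 'I_M -> seq 'X_{1..M}) (cf : 'I_M -> 'X_{1..M} -> {poly K}).
Hypothesis supp_deg : forall j m, m \in supp j -> (mdeg m < D)%N.

Definition mono (x : 'I_M -> K) (m : 'X_{1..M}) : K := \prod_i x i ^+ m i.

Definition solves (t : K) (x : 'I_M -> K) :=
  forall j, x j ^+ D = \sum_(m <- supp j) (cf j m).[t] * mono x m.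

Lemma monoD x m1 m2 : mono x (m1 + m2)%MM = mono x m1 * mono x m2.
Proof. by rewrite -big_split; apply: eq_bigr => i _; rewrite mnmDE exprD. Qed.

Lemma monoU x j n : mono x (U_(j) *+ n)%MM = x j ^+ n.
Proof.
rewrite /mono (bigD1 j) //= big1 => [|i ij].
  by rewrite mulmnE mnm1E eqxx mul1n mulr1.
by rewrite mulmnE mnm1E eq_sym (negPf ij).
Qed.

(** A pointwise form of finiteness over K[t]: the coefficients [c] do not depend on the solution,
    and only the D^M monomials with all exponents below D occur. *)
Definition reducible (F : K -> ('I_M -> K) -> K) :=
  exists c : {ffun 'I_M -> 'I_D} -> {poly K}, forall t x, solves t x ->
    F t x = \sum_s (c s).[t] * \prod_i x i ^+ s i.

Lemma reducible_sum (T : eqType) (r : seq T) (p : T -> {poly K})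
    (F : T -> K -> ('I_M -> K) -> K) :
  (forall i, i \in r -> reducible (F i)) ->
  reducible (fun t x => \sum_(i <- r) (p i).[t] * F i t x).
Proof.
elim: r => [|i r IH] h.
  by exists (fun=> 0) => t x _; rewrite big_nil big1 // => s _; rewrite horner0 mul0r.
have [c hc] := h i (mem_head _ _).
have [c' hc'] : reducible (fun t x => \sum_(i <- r) (p i).[t] * F i t x).
  by apply: IH => j jr; apply: h; rewrite inE jr orbT.
exists (fun s => p i * c s + c' s) => t x sol.
rewrite big_cons (hc _ _ sol) (hc' _ _ sol) mulr_sumr -big_split /=.
by apply: eq_bigr => s _; rewrite hornerD hornerM; ring.
Qed.

(** Replacing a factor x_j^D by the right-hand side of its equation lowers the total degree, by
    [supp_deg], so the rewriting terminates. *)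
Lemma reducible_mono m : reducible (fun _ x => mono x m).
Proof.
have [d] := ubnP (mdeg m); elim: d m => // d IH m md.
have [/existsP[j mj]|] := boolP [exists j, (D <= m j)%N]; last first.
  rewrite negb_exists => /forallP mD.
  have mD' i : (m i < D)%N by rewrite ltnNge.
  exists (fun s => if s == [ffun i => Ordinal (mD' i)] then 1 else 0) => t x _.
  rewrite (bigD1 [ffun i => Ordinal (mD' i)]) //= eqxx hornerC mul1r.
  rewrite [X in _ + X]big1 ?addr0 => [|s /negPf->]; last by rewrite horner0 mul0r.
  by apply: eq_bigr => i _; rewrite ffunE.
pose m1 := (m - U_(j) *+ D)%MM.
have mE : m = (m1 + U_(j) *+ D)%MM.
  rewrite /m1 submK //; apply/mnm_lepP => i; rewrite mulmnE mnm1E.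
  by have [<-|] := eqVneq j i; rewrite ?mul1n ?mul0n.
have [c hc] : reducible
    (fun t x => \sum_(m' <- supp j) (cf j m').[t] * mono x (m1 + m')%MM).
  apply: (@reducible_sum _ _ _ (fun m' _ x => mono x (m1 + m')%MM)) => m' m's.
  apply: IH; apply: leq_trans (_ : mdeg m <= d)%N => //.
  rewrite mE !mdegD mdegMn mdeg1 mul1n ltn_add2l; exact: supp_deg m's.
exists c => t x sol; rewrite -hc // mE monoD monoU sol mulr_sumr.
by apply: eq_bigr => m' _; rewrite monoD; ring.
Qed.

(** Multiplication by x_j acts on the monomials with exponents below D through a matrix over K[t].
    At a solution the vector of their values is an eigenvector with eigenvalue x_j, nonzero because
    the monomial 1 is among them; so the characteristic polynomial vanishes at x_j. *)
Lemma solves_integral (j : 'I_M) : (0 < D)%N ->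
  exists (P : {poly {poly K}}) n, [/\ P \is monic, size P = n.+2 &
    forall t x, solves t x -> P.[(x j)%:P].[t] = 0].
Proof.
move=> D0; pose S := {ffun 'I_M -> 'I_D}.
have red (s : S) : exists c : S -> {poly K}, forall t x, solves t x ->
    x j * \prod_i x i ^+ s i = \sum_s' (c s').[t] * \prod_i x i ^+ s' i.
  have [c hc] := reducible_mono ([multinom (s i : nat) | i < M] + U_(j))%MM.
  exists c => t x sol; rewrite -hc // monoD -[U_(j)%MM]mulm1n monoU expr1 mulrC.
  by congr (_ * _); apply: eq_bigr => i _; rewrite mnmE.
have [c hc] := choice red.
have s0 : S by exact: [ffun=> Ordinal D0].
have S0 : (0 < #|S|)%N by apply/card_gt0P; exists s0.
pose A : 'M[{poly K}]_#|S| := \matrix_(a, b) c (enum_val b) (enum_val a).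
exists (char_poly A), #|S|.-1; split; first exact: char_poly_monic.
  by rewrite size_char_poly prednK.
move=> t x sol.
have -> : (char_poly A).[(x j)%:P].[t] =
    (char_poly (map_mx (horner_eval t) A)).[x j].
  rewrite -map_char_poly [RHS]horner_coef (size_map_poly_id0 (f := horner_eval t)).
    rewrite [_.[(x j)%:P]]horner_coef horner_sum; apply: eq_bigr => i _.
    by rewrite hornerM -polyC_exp hornerC coef_map.
  by rewrite (monicP (char_poly_monic A)) /horner_eval hornerC oner_neq0.
apply/rootP; rewrite -eigenvalue_root_char; apply/eigenvalueP.
pose v : 'rV[K]_#|S| := \row_a \prod_i x i ^+ (enum_val a : S) i.
exists v.
  apply/rowP => b; rewrite !mxE (hc _ _ _ sol) [RHS](reindex (enum_val : 'I_#|S| -> S)) /=; last first.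
    by apply: onW_bij; exact: enum_val_bij.
  by apply: eq_bigr => a _; rewrite !mxE mulrC.
apply/eqP => /rowP/(_ (enum_rank ([ffun=> Ordinal D0] : S))).
rewrite !mxE enum_rankK big1 => [/eqP|i _]; first by rewrite oner_eq0.
by rewrite ffunE expr0.
Qed.

End Elimination.

(** * Penalised least squares *)

Lemma vanish_meval (K : numFieldType) (U : ultrafilter) n (p : {mpoly K[n]})
    (x : nat -> 'I_n -> K) c :
  (forall i, vanish U (fun k => x k i - c i)) ->
  vanish U (fun k => p.@[x k] - p.@[c]).
Proof.
move=> h; apply: (@vanish_ext _ _ (fun k => \sum_(m <- msupp p)
    (p@_m * (\prod_i x k i ^+ m i - \prod_i c i ^+ m i)))).
  by move=> k; rewrite !mevalE -sumrB; apply: eq_bigr => m _; rewrite mulrBr.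
apply: vanish_sum => m _; apply: vanishMl (bounded_cst _ _) _.
by apply: vanish_lim_prod => i _; exact: vanish_limX.
Qed.

Section Minimum.
Variables (R : realType) (M : nat).
Local Notation C := R[i].
Local Notation "x %:c" := (real_complex R x) (at level 2, left associativity).

Definition real_point (v : 'I_M -> R) : 'I_M -> C := fun i => (v i)%:c.

(** Since G is nonnegative, the penalty bounds each coordinate of a minimising sequence; the
    standard part of that sequence is a minimum by continuity. The coefficients of G are complex,
    but its values at real points are real by the order of C. *)
Lemma real_poly_coercive_min (G : {mpoly C[M]}) (t : R) (d : nat) :
  0 < t -> (forall v, 0 <= G.@[real_point v]) ->
  let H := G + \sum_i (t%:c)%:MP * 'X_i ^+ d.+1.*2 in
  exists v, forall w, H.@[real_point v] <= H.@[real_point w].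
Proof.
move=> t0 G0 H.
have HE v : H.@[real_point v] =
    G.@[real_point v] + (\sum_i t * v i ^+ d.+1.*2)%:c.
  rewrite /H mevalD raddf_sum rmorph_sum; congr (_ + _); apply: eq_bigr => i _ /=.
  by rewrite mevalM mevalC rmorphXn /= mevalXU rmorphM rmorphXn.
have sq0 (x : R) : 0 <= x ^+ d.+1.*2 by rewrite -mul2n exprM exprn_ge0 // sqr_ge0.
have S0 (v : 'I_M -> R) : 0 <= \sum_i t * v i ^+ d.+1.*2.
  by apply: sumr_ge0 => i _; apply: mulr_ge0 => //; apply: ltW.
pose h v := complex.Re H.@[real_point v].
have hE v : H.@[real_point v] = (h v)%:c.
  have : 0 <= H.@[real_point v] by rewrite HE addr_ge0 // lecR.
  by rewrite /h; case: (H.@[_]) => a b; rewrite lecE /= => /andP[/eqP->].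
have hge v i : t * v i ^+ d.+1.*2 <= h v.
  rewrite -lecR -/(real_complex R _) -hE HE.
  apply: le_trans (_ : (\sum_i t * v i ^+ d.+1.*2)%:c <= _); last by rewrite lerDr.
  rewrite lecR (bigD1 i) //= lerDl; apply: sumr_ge0 => j _.
  by apply: mulr_ge0 => //; apply: ltW.
have h0 v : 0 <= h v by rewrite -lecR -/(real_complex R _) -hE HE addr_ge0 // lecR.
pose E : classical_sets.set R := fun r => exists v, r = h v.
have infE : classical_sets.has_inf E.
  split; first by exists (h (fun=> 0)); exists (fun=> 0).
  by exists 0 => _ [v ->].
pose I := reals.inf E.
have near k : exists v, h v < I + k.+1%:R^-1.
  have [|_ [v ->] hv] := @inf_adherent R E k.+1%:R^-1 _ infE.
    by rewrite invr_gt0 ltr0n.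
  by exists v.
have [v hv] := choice near.
have [U] := ultrafilter_exists.
have bv i : bounded U (fun k => v k i).
  apply: (@bounded_of_pow U R (fun k => v k i) d.+1.*2) => //.
  exists ((I + 1) / t); apply: largelyT => k.
  rewrite ger0_norm // ler_pdivlMr // mulrC.
  apply: le_trans (hge _ i) (le_trans (ltW (hv k)) _).
  by rewrite lerD2l invf_le1 ?ltr0n // ler1n.
have [c hc] := choice (fun i => real_standard_part (bv i)).
exists c => w.
have vH : vanish U (fun k => H.@[real_point (v k)] - H.@[real_point c]).
  apply: vanish_meval => i.
  by apply: vanish_ext (vanish_complex (hc i)) => k; rewrite /real_point -rmorphB.
rewrite !hE lecR; apply: le_trans (_ : I <= _); last first.
  by apply: ge_inf; [case: infE|exists w].
rewrite leNgt; apply/negP => Ic.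
pose e := (h c - I) / 2.
have e0 : 0 < e by rewrite divr_gt0 // subr_gt0.
have ec0 : 0 < e%:c by rewrite ltcR.
have [k [Nk]] := largely_ex (largelyI (@vanish_harmonic R U e e0) (vH _ ec0)).
rewrite !hE -rmorphB /= normc_def /= expr0n addr0 sqrtr_sqr ltcR ltr_norml => /andP[he _].
move: Nk (hv k) he; rewrite ger0_norm ?invr_ge0 ?ler0n //.
have : I + e = h c - e by rewrite /e; field.
move: (h (v k)) (h c) (k.+1%:R^-1) (e) => a b r e' eE re ar ab.
lra.
Qed.

Lemma horner_min_deriv0 (p : {poly C}) (s : R) :
  (forall x : R, p.[s%:c] <= p.[x%:c]) -> p^`().[s%:c] = 0.
Proof.
move=> h; pose q := p \Po ('X + (s%:c)%:P).
have q0 (x : R) : q.[0] <= q.[x%:c].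
  by rewrite !horner_comp !hornerE -rmorphD; apply: h.
have -> : p^`().[s%:c] = q`_1.
  have := deriv_comp p ('X + (s%:c)%:P); rewrite -/q derivD derivX derivC addr0 mulr1.
  move=> /(congr1 (horner^~ 0)); rewrite horner_comp !hornerE => <-.
  by rewrite horner_coef0 coef_deriv.
pose r := drop_poly 2 q.
have qE x : q.[x] = q.[0] + x * (q`_1 + x * r.[x]).
  rewrite -{1}(poly_take_drop 2 q) -/r hornerD hornerM hornerXn.
  rewrite (_ : (take_poly 2 q).[x] = q.[0] + x * q`_1); last first.
    rewrite horner_poly !big_ord_recr big_ord0 /= add0r horner_coef0.
    by rewrite expr0 mulr1 expr1 mulrC.
  by ring.
have ge x : 0 < x -> 0 <= q`_1 + x%:c * r.[x%:c].
  move=> x0; have := q0 x; rewrite [q.[x%:c]]qE lerDl pmulr_rge0 // ltcR //.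
have le x : 0 < x -> 0 <= - q`_1 + x%:c * r.[(- x)%:c].
  move=> x0; have := q0 (- x); rewrite [q.[(- x)%:c]]qE lerDl rmorphN /= mulNr -mulrN.
  by rewrite pmulr_rge0 ?ltcR // opprD mulNr opprK.
have [U] := ultrafilter_exists.
pose x k : R := k.+1%:R^-1.
have x0 k : 0 < x k by rewrite invr_gt0 ltr0n.
have vx : vanish U (fun k => (x k)%:c) := vanish_complex (@vanish_harmonic R U).
have vnx : vanish U (fun k => (- x k)%:c).
  by apply: vanish_ext (vanishN vx) => k; rewrite rmorphN.
have b1 := bounded_horner r (vanish_bounded vx).
have b2 := bounded_horner r (vanish_bounded vnx).
have v1 := vanishMr vx b1; have v2 := vanishMr vx b2.
apply: (@vanish_cst U).
(* The nonnegative quantities of [ge] and [le] add up to x (r(x) + r(-x)), which tends to 0; hence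
   so does each of them. *)
have v3 : vanish U (fun k => q`_1 + (x k)%:c * r.[(x k)%:c]).
  apply: vanish_le (vanishD v1 v2); apply: largelyT => k.
  rewrite !ger0_norm ?ge //.
    by rewrite -subr_ge0; have := le _ (x0 k); congr (is_true (0 <= _)); ring.
  by have := addr_ge0 (ge _ (x0 k)) (le _ (x0 k)); congr (is_true (0 <= _)); ring.
by apply: vanish_ext (vanishB v3 v1) => k; ring.
Qed.

End Minimum.

Section PartialDerivative.
Variables (K : fieldType) (M : nat) (x : 'I_M -> K) (i : 'I_M).

Definition slice (G : {mpoly K[M]}) : {poly K} :=
  mmap (@polyC K) (fun j => if j == i then 'X else (x j)%:P) G.

Lemma horner_slice G s :
  (slice G).[s] = G.@[fun j => if j == i then s else x j].
Proof.
rewrite /slice /mmap horner_sum mevalE; apply: eq_bigr => m _.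
rewrite hornerM hornerC horner_prod; congr (_ * _); apply: eq_bigr => j _.
by rewrite horner_exp; case: eqP => _; rewrite !hornerE.
Qed.

Lemma deriv_slice G : (slice G)^`().[x i] = G^`M(i).@[x].
Proof.
have -> : G^`M(i).@[x] = \sum_(m <- msupp G) (G@_m *: 'X_[m])^`M(i).@[x].
  by rewrite {1}(mpolyE G) (raddf_sum (mderiv i)) raddf_sum.
rewrite /slice /mmap raddf_sum horner_sum /=; apply: eq_bigr => m _.
rewrite mderivZ mevalZ mderivX mevalZ mevalX mul_polyC derivZ hornerZ.
congr (_ * _); rewrite /mmap1 (bigD1 i) //= eqxx.
rewrite (eq_bigr (fun j => (x j ^+ m j)%:P)) => [|j /negPf ->]; last by rewrite polyC_exp.
rewrite -rmorph_prod derivM derivC mulr0 addr0 derivXn hornerM hornerC.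
rewrite [X in _ = _ * X](bigD1 i) //= mnmBE mnm1E eqxx subn1.
rewrite hornerMn hornerXn mulrA mulr_natl; congr (_ * _); apply: eq_bigr => j ji.
by rewrite mnmBE mnm1E eq_sym (negPf ji) subn0.
Qed.

End PartialDerivative.

Section CriticalPoint.
Variable R : realType.
Local Notation C := R[i].
Local Notation "x %:c" := (real_complex R x) (at level 2, left associativity).

Lemma penalised_critical_point (M : nat) (G : {mpoly C[M]}) (t : R) (d : nat) :
  0 < t -> (forall v, 0 <= G.@[real_point v]) ->
  exists v : 'I_M -> R,
    (forall w, G.@[real_point v] <=
       G.@[real_point w] + t%:c * (\sum_i w i ^+ d.+1.*2)%:c) /\
    (forall i, (d.+1.*2)%:R * t%:c * (v i)%:c ^+ d.*2.+1
       = - G^`M(i).@[real_point v]).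
Proof.
move=> t0 G0; have [v hv] := real_poly_coercive_min d t0 G0.
set H := G + _ in hv; exists v; split=> [w|i].
  have HE u : H.@[real_point u] =
      G.@[real_point u] + t%:c * (\sum_i u i ^+ d.+1.*2)%:c.
    rewrite /H mevalD raddf_sum rmorph_sum mulr_sumr; congr (_ + _).
    by apply: eq_bigr => i _ /=; rewrite mevalM mevalC rmorphXn /= mevalXU rmorphXn.
  rewrite -HE; apply: le_trans (hv w); rewrite HE lerDl mulr_ge0 // lecR; first exact: ltW.
  by apply: sumr_ge0 => i _; rewrite -mul2n exprM exprn_ge0 // sqr_ge0.
have := @horner_min_deriv0 R (slice (real_point v) i H) (v i) _.
rewrite deriv_slice => h; apply/eqP; rewrite -addr_eq0 -[X in _ == X]h; last first.
  move=> x; rewrite !horner_slice.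
  have -> : H.@[fun j => if j == i then (v i)%:c else real_point v j] = H.@[real_point v].
    by apply: meval_eq => j; case: eqP => // ->.
  have -> : H.@[fun j => if j == i then x%:c else real_point v j] =
     H.@[real_point (fun j => if j == i then x else v j)].
    by apply: meval_eq => j; rewrite /real_point; case: eqP.
  exact: hv.
have dS : (\sum_j (t%:c)%:MP * 'X_j ^+ d.+1.*2 : {mpoly C[M]})^`M(i) =
    (t%:c * (d.+1.*2)%:R) *: 'X_i ^+ d.*2.+1.
  rewrite (raddf_sum (mderiv i)) /= (bigD1 i) //= big1 => [|j ji]; last first.
    by rewrite mderiv_mulC mpolyXn mderivX mulmnE mnm1E (negPf ji) mul0n scale0r mulr0.
  rewrite addr0 mderiv_mulC mpolyXn mderivX mulmnE mnm1E eqxx mul1n mul_mpolyC.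
  rewrite scalerA mpolyXn; congr (_ *: 'X_[_]).
  by apply/mnmP => j; rewrite mnmBE !mulmnE mnm1E; case: eqP; rewrite ?mul1n ?mul0n // doubleS subn1.
rewrite /H mderivD mevalD dS mevalZ rmorphXn /= mevalXU /real_point.
by apply/eqP; ring.
Qed.

End CriticalPoint.

(** * Curve selection *)

Section Limits.
Variables (U : ultrafilter) (K : numFieldType).
Implicit Types (x y s t : nat -> K).

Lemma vanish_of_pow x n : (0 < n)%N -> vanish U (fun k => x k ^+ n) -> vanish U x.
Proof.
move=> n0 vx e e0; have en0 : 0 < e ^+ n by rewrite exprn_gt0.
apply: largelyS (vx _ en0) => k.
by rewrite normrX ltr_pXn2r ?nnegrE ?(ltW e0).
Qed.

Lemma vanish_horner (B : {poly K}) s :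
  vanish U s -> vanish U (fun k => B.[s k] - B.[0]).
Proof.
move=> vs; have bs := vanish_bounded vs.
apply: (@vanish_ext _ _ (fun k => s k * \sum_(i < size B) (drop_poly 1 B)`_i * s k ^+ i)).
  by move=> k; rewrite horner_sub0.
apply: vanishMr => //; apply: bounded_sum => i _.
by apply: boundedM (bounded_cst _ _) (boundedX _ bs).
Qed.

(** If B(s)/s^n converges with n > 0, then B(s) tends to 0, so B(0) = 0 and a factor X can be
    divided out; repeat. *)
Lemma poly_div_limit (B : {poly K}) s n c :
  (forall k, s k != 0) -> vanish U s ->
  vanish U (fun k => B.[s k] / s k ^+ n - c) ->
  exists E : {poly K}, B = E * 'X^n /\ E.[0] = c.
Proof.
move=> s0 vs; elim: n B => [|n IH] B vB.
  exists B; rewrite mulr1; split=> //.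
  have vB' : vanish U (fun k => B.[s k] - c).
    by apply: vanish_ext vB => k; rewrite divr1.
  by apply: vanish_lim vB'; exact: vanish_horner.
have B0 : B.[0] = 0.
  apply: vanish_lim (vanish_horner B vs) _.
  have vsn : vanish U (fun k => s k ^+ n.+1).
    apply: (vanish_ext (fun k => esym (exprS (s k) n))).
    by apply: vanishMr => //; apply: boundedX; exact: vanish_bounded.
  apply: vanish_ext (vanishMl (vanish_lim_bounded vB) vsn) => k.
  by rewrite subr0 divfK // expf_neq0.
have BE : B = drop_poly 1 B * 'X^1.
  by apply: poly_divXn => -[|//] _; rewrite -horner_coef0.
have [|E [EB E0]] := IH (drop_poly 1 B).
  apply: vanish_ext vB => k; rewrite {1}BE hornerM hornerXn expr1 exprS.
  by congr (_ - _); field; rewrite expf_neq0 ?s0.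
by exists E; split=> //; rewrite {1}BE EB expr1 exprSr mulrA.
Qed.

Lemma vanish_diff_prod (I : Type) (r : seq I) (e : I -> nat) (x y : I -> nat -> K)
    (T : nat -> K) :
  (forall i, bounded U (x i)) -> (forall i, bounded U (y i)) ->
  (forall i, bounded U (fun k => (x i k - y i k) / T k)) ->
  bounded U (fun k => (\prod_(i <- r) x i k ^+ e i - \prod_(i <- r) y i k ^+ e i) / T k).
Proof.
move=> bx by_ bxy.
have step x1 x2 y1 y2 : bounded U x1 -> bounded U y2 ->
    bounded U (fun k => (x1 k - y1 k) / T k) ->
    bounded U (fun k => (x2 k - y2 k) / T k) ->
    bounded U (fun k => (x1 k * x2 k - y1 k * y2 k) / T k).
  move=> b1 b2 d1 d2; apply: bounded_ext (boundedD (boundedM b1 d2) (boundedM d1 b2)) => k.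
  ring.
have zero z : bounded U (fun k => (z k - z k) / T k).
  by apply: bounded_ext (bounded_cst U 0) => k; rewrite subrr mul0r.
elim: r => [|i r IH].
  by apply: bounded_ext (zero (fun=> 1)) => k; rewrite !big_nil.
apply: (@bounded_ext _ _ (fun k => (x i k ^+ e i * \prod_(i <- r) x i k ^+ e i
   - y i k ^+ e i * \prod_(i <- r) y i k ^+ e i) / T k)).
  by move=> k; rewrite !big_cons.
apply: (step) => //; first exact: boundedX.
  by apply: bounded_prod => j _; exact: boundedX.
elim: (e i) => [|n IHn]; first exact: zero.
apply: bounded_ext (step _ _ _ _ (bx i) (boundedX n (by_ i)) (bxy i) IHn) => k.
by rewrite !exprS.
Qed.

End Limits.

Section CurveSelection.
Variable R : realType.
Local Notation C := R[i].
Local Notation "x %:c" := (real_complex R x) (at level 2, left associativity).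
Local Notation tofrac := (@FracField.tofrac _).
Local Notation "x %:F" := (tofrac x).

Lemma meval_map_mpoly (A B : comNzRingType) (f : {rmorphism A -> B}) n
    (p : {mpoly A[n]}) (x : 'I_n -> A) :
  (map_mpoly f p).@[fun i => f (x i)] = f p.@[x].
Proof.
rewrite {1}(mpolyE p) (rmorph_sum (map_mpoly f)) raddf_sum mevalE rmorph_sum /=.
apply: eq_bigr => m _; rewrite map_mpolyZ mevalZ map_mpolyX mevalX rmorphM rmorph_prod.
by congr (_ * _); apply: eq_bigr => i _; rewrite rmorphXn.
Qed.

Lemma solve_lin (K : fieldType) (c u p g : K) :
  c != 0 -> u != 0 -> c * u * p = - g -> p = - c^-1 * u^-1 * g.
Proof. by move=> c0 u0 h; rewrite -[g]opprK -h; field; rewrite c0 u0. Qed.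

Lemma solve_lin_term (K : fieldType) (a b c e g u : K) : a != 0 -> u != 0 ->
  u * b * c * (- a^-1 * u^-1 * (g * e)) = - a^-1 * g * b * (c * e).
Proof. by move=> a0 u0; field; rewrite a0 u0. Qed.

(* The critical points of the penalised function, rescaled by t, solve a system
   with leading forms x_j^D and coefficients in C[t], hence are integral over C[t]. *)
Lemma integral_minimising_sequence (M : nat) (G : {mpoly C[M]}) :
  (forall v, 0 <= G.@[real_point v]) ->
  (forall e : C, 0 < e -> exists v, G.@[@real_point R M v] < e) ->
  exists v : nat -> 'I_M -> R, forall U : ultrafilter,
    vanish U (fun k => G.@[real_point (v k)]) /\
    forall j, exists (P : {poly {poly C}}) n, [/\ P \is monic, size P = n.+2 &
      forall k, P.[((k.+1%:R^-1)%:c * (v k j)%:c)%:P].[(k.+1%:R^-1)%:c] = 0].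
Proof.
move=> G0 Ge; pose d := msize G; pose D := d.*2.+1.
pose t k : R := k.+1%:R^-1.
have t0 k : 0 < t k by rewrite invr_gt0 ltr0n.
have [v hv] := choice (fun k => penalised_critical_point d (t0 k) G0).
exists v => U; split=> [e e0|j].
  have e20 : 0 < e / 2 by rewrite divr_gt0.
  (* The minimiser is compared with one fixed [w], whose penalty disappears as t tends to 0. *)
  have [w hw] := Ge _ e20.
  have vt : vanish U (fun k => (t k)%:c * (\sum_i w i ^+ d.+1.*2)%:c).
    exact: vanishMr (vanish_complex (@vanish_harmonic R U)) (bounded_cst _ _).
  apply: largelyS (vt _ e20) => k hk; rewrite ger0_norm //.
  apply: le_lt_trans ((hv k).1 w) _; rewrite (splitr e); apply: ltrD => //.
  by apply: le_lt_trans hk; apply: real_ler_norm; rewrite -rmorphM /= complex_real.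
pose supp (i : 'I_M) := msupp (G^`M(i)).
(* Multiply v_i^D = - t^-1 G_i(v) / (2d+2), with G_i the partial derivative, by t^D and put x = t v:
   a monomial m of G_i becomes t^(D-1-|m|) x^m, with a nonnegative exponent as |m| < d. *)
pose cf (i : 'I_M) m : {poly C} :=
  (- (d.+1.*2)%:R^-1 * (G^`M(i))@_m) *: 'X^(D.-1 - mdeg m).
have suppP i m : m \in supp i -> (mdeg m < d)%N.
  rewrite mcoeff_msupp mcoeff_deriv => nz.
  have : (m + U_(i))%MM \in msupp G.
    by rewrite mcoeff_msupp; apply: contraNneq nz => ->; rewrite mul0rn.
  by move=> /msize_mdeg_lt; rewrite mdegD mdeg1 addn1; apply: ltn_trans.
have supp_deg i m : m \in supp i -> (mdeg m < D)%N.
  by move=> /suppP/leq_trans; apply; rewrite /D -addnn; lia.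
have [P [n [mP sP hP]]] := solves_integral cf supp_deg j isT.
exists P, n; split=> // k.
have := hP (t k)%:c (fun i => (t k)%:c * (v k i)%:c); apply=> i.
have /= crit := (hv k).2 i.
have tc0 : (t k)%:c != 0 by rewrite gt_eqF // ltcR.
have dc0 : (d.+1.*2)%:R != 0 :> C by rewrite pnatr_eq0.
have vE : (v k i)%:c ^+ D = - (d.+1.*2)%:R^-1 * (t k)%:c^-1 * G^`M(i).@[real_point (v k)].
  exact: solve_lin crit.
rewrite exprMn vE mevalE !mulr_sumr !big_seq; apply: eq_bigr => m ms.
have md := suppP _ _ ms.
have -> : mono (fun i0 => (t k)%:c * (v k i0)%:c) m =
    (t k)%:c ^+ mdeg m * \prod_i0 real_point (v k) i0 ^+ m i0.
  rewrite mdegE -prodrXr -big_split; apply: eq_bigr => i0 _.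
  by rewrite exprMn.
have -> : (t k)%:c ^+ D = (t k)%:c * (t k)%:c ^+ (D.-1 - mdeg m) * (t k)%:c ^+ mdeg m.
  rewrite -mulrA -exprD subnK ?exprS //.
  by apply: ltnW; apply: leq_trans md _; rewrite /= -addnn leq_addr.
rewrite /cf hornerZ hornerXn; exact: solve_lin_term.
Qed.

(** With eps a q-th root of t, the integral quantities t v are replaced by polynomials in eps up to
    O(t^D). Here D exceeds all degrees of the g_i, so that g_i keeps its limit on b/eps^q, which
    forces its value there to be a polynomial. *)
Lemma curve_selection (N : nat) (I : finType) (g : I -> {mpoly C[N]}) (f : I -> C) :
  (forall e : C, 0 < e -> exists a, forall i, `|(g i).@[a] - f i| < e) ->
  exists (b : 'I_N -> {poly C}) (q : nat) (E : I -> {poly C}), forall i,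
    (E i).[0] = f i /\
    mmap (fun c => (c%:P)%:F) (fun j => (b j)%:F / ('X%:F) ^+ q) (g i) = (E i)%:F.
Proof.
move=> clos; have [U] := ultrafilter_exists.
pose M := (N + N)%N; pose ii : C := 'i%C.
pose pt (w : 'I_M -> C) : 'I_N -> C :=
  fun j => w (lshift N j) + ii * w (rshift N j).
pose lq : N.-tuple {mpoly C[M]} :=
  [tuple 'X_(lshift N j) + ii *: 'X_(rshift N j) | j < N].
pose h i := (g i - (f i)%:MP) \mPo lq.
have hE i w : (h i).@[w] = (g i).@[pt w] - f i.
  rewrite comp_mpoly_meval mevalB mevalC; congr (_ - _); apply: meval_eq => j.
  by rewrite tnth_mktuple mevalD mevalZ !mevalXU.
(* At real points, conjugating the coefficients conjugates the value, so G is a sum of squared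
   moduli. *)
pose G : {mpoly C[M]} := \sum_i h i * map_mpoly Num.conj (h i).
have GE v : G.@[real_point v] = \sum_i `|(g i).@[pt (real_point v)] - f i| ^+ 2.
  rewrite raddf_sum; apply: eq_bigr => i _ /=; rewrite mevalM normCK hE.
  congr (_ * _); rewrite -hE -meval_map_mpoly; apply: meval_eq => j.
  by rewrite /real_point /= conj_Creal // complex_real.
have G0 v : 0 <= G.@[real_point v].
  by rewrite GE; apply: sumr_ge0 => i _; rewrite exprn_ge0.
have ptS a : exists v, pt (@real_point R M v) =1 a.
  exists (fun j => match split j with inl j => complex.Re (a j) | inr j => complex.Im (a j) end) => j.
  rewrite /pt /real_point; case: splitP => [j' /= /val_inj <-|j' /= jj']; last first.
    by have := ltn_ord j; rewrite jj' ltnNge leq_addr.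
  case: splitP => [j'' /= jj|j'' /= /addnI/val_inj <-].
    by have := ltn_ord j''; rewrite -jj ltnNge leq_addr.
  by case: (a j') => u w; apply/eqP; rewrite eq_complex /=; apply/andP; split; apply/eqP; ring.
have Ge (e : C) : 0 < e -> exists v, G.@[@real_point R M v] < e.
  move=> e0; have ek0 k : 0 < (k.+1%:R^-1 : R)%:c by rewrite ltcR invr_gt0 ltr0n.
  have [a ha] := choice (fun k => clos _ (ek0 k)).
  have [v hv] := choice (fun k => ptS (a k)).
  suff : vanish U (fun k => G.@[real_point (v k)]).
    by move=> /(_ _ e0)/largely_ex[k]; rewrite ger0_norm // => hk; exists (v k).
  apply: (vanish_ext (fun k => esym (GE (v k)))); apply: vanish_sum => i _.
  have vi : vanish U (fun k => `|(g i).@[pt (real_point (v k))] - f i|).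
    apply: vanish_le (vanish_complex (@vanish_harmonic R U)); apply: largelyT => k.
    rewrite normr_id [X in _ <= X]ger0_norm ?(ltW (ek0 k)) //.
    by rewrite (meval_eq _ (hv k)) ltW.
  exact: vanishMr vi (vanish_bounded vi).
have [v /(_ U)[vG hP]] := integral_minimising_sequence G0 Ge.
pose t k : C := (k.+1%:R^-1)%:c.
have t0 k : 0 < t k by rewrite ltcR invr_gt0 ltr0n.
have vt : vanish U t := vanish_complex (@vanish_harmonic R U).
have bt := vanish_bounded vt.
pose x (j : 'I_M) k : C := t k * (v k j)%:c.
have {}hP j : exists (P : {poly {poly C}}) n, [/\ P \is monic, size P = n.+2 &
    forall k, P.[(x j k)%:P].[t k] = 0] := hP j.
have tn0 k : t k != 0 by rewrite (gt_eqF (t0 k)).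
move: @x hP; move: t t0 vt bt tn0 => t t0 vt bt tn0 x hP.
pose D := \max_i msize (g i).
have pui j : exists qb : nat * {poly C}, (0 < qb.1)%N /\
    forall s : nat -> C, (forall k, 0 < s k) -> (forall k, s k ^+ qb.1 = t k) ->
    bounded U (fun k => (x j k - qb.2.[s k]) / t k ^+ D).
  have [P [n [mP sP PE]]] := hP j.
  have [|q [b hb]] := @puiseux_approx U C n P D t (x j) mP sP t0 bt.
    by apply: bounded_ext (bounded_cst U 0) => k; rewrite PE mul0r.
  by exists (q, b).
have [qb hqb] := choice pui.
have bx j : bounded U (x j).
  have [P [n [mP sP PE]]] := hP j.
  apply: (bounded_root mP sP bt).
  by apply: bounded_ext (bounded_cst U 0) => k; rewrite PE.
(* A common multiple of all ramification indices, so that one root of t serves every coordinate. *)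
pose q := (\prod_j (qb j).1)%N.
have q0 : (0 < q)%N by apply: prodn_gt0 => j; case: (hqb j).
pose s k := q.-root (t k).
have sq k : s k ^+ q = t k by rewrite rootCK.
have s0 k : 0 < s k by rewrite rootC_gt0.
have sn0 k : s k != 0 by rewrite gt_eqF.
have vs : vanish U s by apply: (vanish_of_pow q0); apply: vanish_ext vt => k.
pose be j := (qb j).2 \Po 'X^(q %/ (qb j).1).
have hbe j : bounded U (fun k => (x j k - (be j).[s k]) / t k ^+ D).
  have [qj0 /(_ (fun k => s k ^+ (q %/ (qb j).1)))] := hqb j.
  move=> /(_ (fun k => exprn_gt0 _ (s0 k))) hb.
  apply: bounded_ext (hb _) => k; first by rewrite horner_comp hornerXn.
  by rewrite -exprM divnK // /q (bigD1 j) //= dvdn_mulr.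
pose b j := be (lshift N j) + ii *: be (rshift N j).
pose y j k := x (lshift N j) k + ii * x (rshift N j) k.
have hb j : bounded U (fun k => (y j k - (b j).[s k]) / t k ^+ D).
  apply: bounded_ext (boundedD (hbe (lshift N j))
    (boundedM (bounded_cst U ii) (hbe (rshift N j)))) => k.
  by rewrite /y /b hornerD hornerZ; ring.
have by_ j : bounded U (y j).
  exact: boundedD (bx _) (boundedM (bounded_cst U ii) (bx _)).
have bb j : bounded U (fun k => (b j).[s k]) := bounded_horner _ (vanish_bounded vs).
have yE k : (fun j => y j k / t k) =1 pt (real_point (v k)).
  move=> j; rewrite /y /x /pt /real_point; field.
  exact: tn0.
have mD i m : m \in msupp (g i) -> (mdeg m < D)%N.
  by move=> /msize_mdeg_lt/leq_trans; apply; exact: (leq_bigmax i).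
have prod_frac (F : fieldType) (z : 'I_N -> F) u (m : 'X_{1..N}) :
    \prod_j (z j / u) ^+ m j = (\prod_j z j ^+ m j) / u ^+ mdeg m.
  rewrite mdegE -prodrXr -prodf_div; apply: eq_bigr => j _.
  by rewrite expr_div_n.
have lim i : vanish U (fun k => (g i).@[fun j => (b j).[s k] / t k] - f i).
  have v1 : vanish U (fun k => (g i).@[pt (real_point (v k))] - f i).
    apply: (@vanish_of_pow _ _ _ 2) => //; apply: vanish_le vG; apply: largelyT => k.
    rewrite normrX [X in _ <= X]ger0_norm // GE (bigD1 i) //= lerDl.
    by apply: sumr_ge0 => i' _; rewrite exprn_ge0.
  have v2 : vanish U (fun k => (g i).@[fun j => y j k / t k] -
                               (g i).@[fun j => (b j).[s k] / t k]).
    apply: (@vanish_ext _ _ (fun k => \sum_(m <- msupp (g i)) (g i)@_m *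
       (\prod_j (y j k / t k) ^+ m j - \prod_j ((b j).[s k] / t k) ^+ m j))).
      by move=> k; rewrite !mevalE -sumrB; apply: eq_bigr => m _; rewrite mulrBr.
    apply: (vanish_ext (fun k => esym (big_seq _ _ _ _))); apply: vanish_sum => m ms; have mDm := mD i m ms.
    apply: vanishMl (bounded_cst _ _) _.
    have vtm : vanish U (fun k => t k ^+ (D - mdeg m).-1.+1).
      apply: (vanish_ext (fun k => esym (exprS _ _))).
      exact: vanishMr vt (boundedX _ bt).
    have := vanish_diff_prod (index_enum 'I_N) m by_ bb hb.
    move=> /(vanishMr vtm); apply: vanish_ext => k.
    rewrite !prod_frac prednK ?subn_gt0 //.
    have -> : t k ^+ D = t k ^+ (D - mdeg m) * t k ^+ mdeg m.
      by rewrite -exprD subnK // ltnW.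
    by rewrite -mulrBl invfM mulrCA mulVKf ?expf_neq0.
  apply: vanish_ext (vanishB v1 v2) => k.
  by rewrite -(meval_eq _ (yE k)); ring.
pose B i : {poly C} := \sum_(m <- msupp (g i))
  ((g i)@_m *: \prod_j b j ^+ m j) * 'X^(q * (D - mdeg m)).
(* [B i] is the numerator of g_i(b/X^q) over the denominator X^(q D). A general [phi] covers both
   evaluation at s_k and the embedding into C(eps). *)
have BE (F : fieldType) (phi : {rmorphism {poly C} -> F}) i : phi 'X != 0 ->
    mmap (fun c => phi c%:P) (fun j => phi (b j) / phi 'X ^+ q) (g i) =
    phi (B i) / phi 'X ^+ (q * D).
  move=> X0; rewrite /mmap /B rmorph_sum mulr_suml !big_seq; apply: eq_bigr => m ms.
  rewrite /mmap1 prod_frac -mul_polyC !rmorphM rmorph_prod rmorphXn.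
  rewrite (eq_bigr (fun j => phi (b j ^+ m j))) => [|j _]; last by rewrite rmorphXn.
  have -> : phi 'X ^+ (q * D) = phi 'X ^+ (q * (D - mdeg m)) * (phi 'X ^+ q) ^+ mdeg m.
    by rewrite -exprM -exprD -mulnDr subnK // ltnW // (mD i).
  by rewrite invfM !mulrA mulfK ?expf_neq0.
have cancelXn (F : fieldType) (phi : {rmorphism {poly C} -> F}) E n : phi 'X != 0 ->
    phi (E * 'X^n) / phi 'X ^+ n = phi E.
  by move=> X0; rewrite rmorphM rmorphXn mulfK // expf_neq0.
have ex i : exists E : {poly C}, B i = E * 'X^(q * D) /\ E.[0] = f i.
  apply: (@poly_div_limit U C (B i) s) => //.
  apply: vanish_ext (lim i) => k; congr (_ - _).
  have := BE C (horner_eval (s k)) i; rewrite /= /horner_eval hornerX exprM sq => <- //.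
  by rewrite /mmap mevalE; apply: eq_bigr => m _; rewrite hornerC.
have [E hE'] := choice ex.
exists b, q, E => i; have [BEi E0] := hE' i; split=> //.
have X0 : 'X%:F != 0 :> {fraction {poly C}} by rewrite tofrac_eq0 polyX_eq0.
apply: etrans (BE {fraction {poly C}} tofrac i X0) _.
by rewrite BEi; apply: (cancelXn {fraction {poly C}} tofrac).
Qed.

End CurveSelection.

(** * From the closure of sums of powers to border Waring rank *)

Section BorderWaring.
Variable R : realType.
Local Notation C := R[i].
Local Notation "x %:c" := (real_complex R x) (at level 2, left associativity).
Local Notation tofrac := (@FracField.tofrac _).
Local Notation "x %:F" := (tofrac x).

Definition sum_powers (A : comNzRingType) (n d r : nat) (L : 'M[A]_(r, n)) : {mpoly A[n]} :=
  \sum_(i < r) linForm (row i L) ^+ d.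

Lemma map_linForm (A B : comNzRingType) (phi : {rmorphism A -> B}) n (a : 'rV[A]_n) :
  map_mpoly phi (linForm a) = linForm (map_mx phi a).
Proof.
rewrite /linForm rmorph_sum; apply: eq_bigr => j _ /=.
by rewrite map_mpolyZ map_mpolyX mxE.
Qed.

Lemma map_sum_powers (A B : comNzRingType) (phi : {rmorphism A -> B}) n d r
    (L : 'M[A]_(r, n)) m :
  (sum_powers d (map_mx phi L))@_m = phi (sum_powers d L)@_m.
Proof.
rewrite -mcoeff_map_mpoly; congr (_@_m).
rewrite /sum_powers rmorph_sum; apply: eq_bigr => i _ /=.
by rewrite rmorphXn /= map_linForm map_row.
Qed.

Lemma dhomog_linForm (A : comNzRingType) n (a : 'rV[A]_n) : linForm a \is 1.-homog.
Proof.
apply: rpred_sum => j _; apply: dhomogZ; by rewrite dhomogX /= mdeg1.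
Qed.

Lemma dhomog_sum_powers (A : comNzRingType) n d r (L : 'M[A]_(r, n)) :
  sum_powers d L \is d.-homog.
Proof.
apply: rpred_sum => i _.
by have := dhomogMn d (dhomog_linForm (row i L)); rewrite mul1n.
Qed.

Lemma horner_lipschitz0 (E : {poly C}) : exists2 M : R, 0 < M &
  forall t : C, `|t| <= 1 -> `|E.[t] - E.[0]| <= `|t| * M%:c.
Proof.
pose M' : C := \sum_(i < size E) `|(drop_poly 1 E)`_i| + 1.
have M'0 : 0 < M' by rewrite ltr_wpDl // sumr_ge0.
have M'E := gt0_Re M'0.
exists (complex.Re M'); first by move: M'0; rewrite M'E ltcR.
move=> t t1; rewrite -M'E.
rewrite horner_sub0 normrM ler_wpM2l //; apply: le_trans (ler_norm_sum _ _ _) _.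
rewrite ler_wpDr //; apply: ler_sum => i _; rewrite normrM normrX.
by rewrite ler_piMr // exprn_ile1.
Qed.

(** The fraction chosen by [repr] has the form E p / p with an unknown nonzero p. Writing p = X^k q
    with q(0) nonzero shows that p has no zero in a punctured disc around 0. *)
Lemma ratEval_tofrac (E : {poly C}) :
  exists2 h : R, 0 < h & forall t : C, t != 0 -> `|t| < h%:c -> ratEval E%:F t = E.[t].
Proof.
pose a := repr E%:F; pose n := \n_a; pose p := \d_a.
have nE : n = E * p.
  have := FracField.equivf_r (Ratio E 1); rewrite !numden_Ratio ?oner_neq0 // mul1r.
  have -> : \pi_({fraction {poly C}})%qT (Ratio E 1) = E%:F.
    by rewrite /FracField.tofrac; unlock.
  by rewrite -/a -/n -/p => ->.
have p0 : p != 0 by rewrite denom_ratioP.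
have [h h0 hp] : exists2 h : R, 0 < h &
    forall t : C, t != 0 -> `|t| < h%:c -> p.[t] != 0.
  have [k [q nq pE]] := multiplicity_XsubC p 0.
  have {}nq : q.[0] != 0 by move: nq; rewrite p0.
  have [M M0 hM] := horner_lipschitz0 q.
  have q0E : `|q.[0]| = (complex.Re `|q.[0]|)%:c.
    by case: (q.[0]) => u v; rewrite normc_def.
  have q0 : 0 < complex.Re `|q.[0]| by rewrite -(ltcR 0) -q0E normr_gt0.
  exists (Num.min 1 (complex.Re `|q.[0]| / M)); first by rewrite lt_min ltr01 divr_gt0.
  move=> t t0 th; rewrite pE hornerM mulf_neq0 //; last first.
    by rewrite horner_exp hornerXsubC subr0 expf_neq0.
  have lt2 (x : R) : Num.min 1 (complex.Re `|q.[0]| / M) <= x -> `|t| < x%:c.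
    by move=> hx; apply: lt_le_trans th _; rewrite lecR.
  apply/eqP => qt; have := hM t; rewrite qt sub0r normrN q0E => /(_ _)/le_gtF.
  rewrite -ltr_pdivlMr ?ltcR // -fmorph_div lt2 ?ge_min ?lexx ?orbT // => h.
  have : true = false by apply: h; apply/ltW/lt2; rewrite ge_min lexx.
  by [].
exists h => // t t0 th; rewrite /ratEval -/a -/n -/p nE hornerM mulfK //.
exact: hp.
Qed.

Lemma ratLim0_tofrac (E : {poly C}) : ratLim0 E%:F E.[0].
Proof.
move=> e e0; have [h h0 hE] := ratEval_tofrac E.
have [M M0 hM] := horner_lipschitz0 E.
exists (Num.min (Num.min h 1) (e / M)).
  by rewrite !lt_min h0 ltr01 divr_gt0.
move=> t t0 tlt.
have lt3 (x : R) : Num.min (Num.min h 1) (e / M) <= x -> `|t| < x%:c.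
  by move=> hx; apply: lt_le_trans tlt _; rewrite lecR.
rewrite hE //; last by apply: lt3; rewrite !ge_min lexx.
apply: le_lt_trans (hM _ _) _; first by apply/ltW/lt3; rewrite !ge_min lexx !orbT.
rewrite -ltr_pdivlMr ?ltcR // -fmorph_div; apply: lt3.
by rewrite !ge_min lexx !orbT.
Qed.

(** Curve selection is applied to the coefficients of the sum of powers of a generic matrix, whose
    entries are variables. Those of degree at most d are finitely many; the others vanish by
    homogeneity. *)
Lemma border_waring_of_closure n d r (f : {mpoly C[n]}) : f \is d.-homog ->
  (forall e : C, 0 < e -> exists L : 'M[C]_(r, n),
    forall m, `|(sum_powers d L)@_m - f@_m| < e) ->
  hasBorderWaring d f r.
Proof.
move=> hf clos.
pose X : 'M[{mpoly C[r * n]}]_(r, n) := \matrix_(i, j) 'X_(mxvec_index i j).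
pose g (m : 'X_{1..n < d.+1}) : {mpoly C[r * n]} := (sum_powers d X)@_m.
have [|b [q [E hE]]] := @curve_selection R (r * n) _ g (fun m => f@_m).
  move=> e e0; have [L hL] := clos e e0.
  exists (fun k => mxvec L 0 k) => m.
  have := hL m; congr (is_true (`|_ - _| < _)).
  rewrite /g -map_sum_powers; congr ((sum_powers _ _)@_m).
  by apply/matrixP => i j; rewrite !mxE /= mevalXU mxvecE.
pose phi : {rmorphism {mpoly C[r * n]} -> {fraction {poly C}}} :=
  mmap (tofrac \o @polyC C) (fun j => (b j)%:F / ('X%:F) ^+ q).
exists (map_mx phi X) => m; rewrite -/(sum_powers d _).
have [md|md] := ltnP (mdeg m) d.+1.
  have [E0 EF] := hE (BMultinom md).
  by rewrite map_sum_powers -E0 -[phi _]/(mmap _ _ _) EF; apply: ratLim0_tofrac.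
have nd : mdeg m != d by rewrite neq_ltn md orbT.
rewrite (dhomog_nemf_coeff (dhomog_sum_powers _ _) nd) (dhomog_nemf_coeff hf nd).
by have := ratLim0_tofrac 0; rewrite tofrac0 horner0.
Qed.

End BorderWaring.

(** * Elementary symmetric functions, power sums and binary forms *)

Section Newton.
Variable A : comNzRingType.
Implicit Types (s : seq A) (y : A).

(** Its k-th coefficient is the elementary symmetric function e_k of [s]. *)
Definition esym_poly s : {poly A} := \prod_(w <- s) (1 + w *: 'X).

Lemma size_esym_poly s : (size (esym_poly s) <= (size s).+1)%N.
Proof.
rewrite /esym_poly; elim: s => [|w s IH]; first by rewrite big_nil size_poly1.
rewrite big_cons mulrDl mul1r -scalerAl mulrC; apply: leq_trans (size_polyD _ _) _.
rewrite geq_max (leq_trans IH) //=; apply: leq_trans (size_scale_leq _ _) _.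
by apply: leq_trans (size_polyMleq _ _) _; rewrite size_polyX addn2.
Qed.

Lemma esym_poly_cons w s k : (esym_poly (w :: s))`_k = (esym_poly s)`_k +
  w * (if k is k'.+1 then (esym_poly s)`_k' else 0).
Proof.
rewrite {1}/esym_poly big_cons -/(esym_poly s) mulrDl mul1r coefD -scalerAl coefZ coefXM.
by case: k.
Qed.

Lemma esym_poly_coef0 s : (esym_poly s)`_0 = 1.
Proof.
elim: s => [|w s IH]; first by rewrite /esym_poly big_nil coef1.
by rewrite esym_poly_cons IH mulr0 addr0.
Qed.

Lemma prod_shift_esym s y :
  \prod_(w <- s) (y + w) = \sum_(k < (size s).+1) (esym_poly s)`_k * y ^+ (size s - k).
Proof.
elim: s => [|w s IH].
  by rewrite /esym_poly !big_nil big_ord1 coef1 mul1r.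
rewrite big_cons IH mulrDl; under [RHS]eq_bigr do rewrite esym_poly_cons mulrDl.
rewrite big_split /=; congr (_ + _).
  rewrite [RHS]big_ord_recr /= nth_default ?size_esym_poly // mul0r addr0 mulr_sumr.
  apply: eq_bigr => k _; have kn : (k <= size s)%N by rewrite -ltnS.
  by rewrite subSn // exprS; ring.
rewrite [RHS]big_ord_recl /= mulr0 mul0r add0r mulr_sumr.
by apply: eq_bigr => k _; rewrite subSS mulrA.
Qed.

(* The logarithmic derivative of esym_poly is the generating series of the power sums. *)
Lemma deriv_esym_poly s N : exists Q, (esym_poly s)^`() =
  esym_poly s * (\sum_(w <- s) w *: \sum_(l < N) (- w *: 'X) ^+ l) + 'X^N * Q.
Proof.
elim: s => [|w s [Q IH]].
  by exists 0; rewrite /esym_poly !big_nil !mulr0 addr0 -polyC1 derivC.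
have geo : (1 + w *: 'X) * (\sum_(l < N) (- w *: 'X) ^+ l) = 1 - (- w *: 'X) ^+ N.
  by rewrite -[RHS]opprB subrX1 -mulNr opprB scaleNr opprK.
exists ((1 + w *: 'X) * Q + (- w) ^+ N *: (w *: esym_poly s)).
rewrite /esym_poly !big_cons -/(esym_poly s) derivM IH.
rewrite derivD -[1]polyC1 derivC add0r derivZ derivX polyC1.
set S := \sum_(i <- s) _; set g := \sum_(l < N) _ in geo *.
have -> : (1 + w *: 'X) * esym_poly s * (w *: g + S) =
   (1 + w *: 'X) * esym_poly s * S + esym_poly s * (w *: ((1 + w *: 'X) * g)).
  by rewrite -!mul_polyC; ring.
rewrite geo exprZn -!mul_polyC !polyC_exp.
ring.
Qed.

Lemma newton_identity s k : (0 < k)%N ->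
  (esym_poly s)`_k *+ k =
  \sum_(j < k) (esym_poly s)`_j * ((-1) ^+ (k - j).-1 * \sum_(w <- s) w ^+ (k - j)).
Proof.
case: k => // k _; rewrite -coef_deriv.
have [Q ->] := deriv_esym_poly s k.+1.
rewrite coefD coefXnM ltnS leqnn addr0 coefM; apply: eq_bigr => j _; congr (_ * _).
have jk : (j <= k)%N by rewrite -ltnS.
rewrite coef_sum mulr_sumr; apply: eq_bigr => w _; rewrite coefZ coef_sum subSn //=.
have lt : (k - j < k.+1)%N by rewrite ltnS leq_subr.
rewrite (bigD1 (Ordinal lt)) //= big1 => [|l lj]; last first.
  by rewrite exprZn coefZ coefXn [_ == _](negbTE _) ?mulr0 // eq_sym.
by rewrite exprZn coefZ coefXn eqxx mulr1 addr0 (exprNn w) (exprS w); ring.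
Qed.

End Newton.

(** The weights of the powers (y + s w)^d solve a Vandermonde system with distinct nodes 0, ..., d,
    and their d-th roots are moved inside. They depend on [a] only, so one choice serves all pairs
    (y, w). *)
Lemma binary_waring (K : numClosedFieldType) d (a : nat -> K) : (0 < d)%N ->
  exists c : 'I_d.+1 -> K, forall (n : nat) (y w : {mpoly K[n]}),
    \sum_(s < d.+1) (c s *: (y + (s : nat)%:R *: w)) ^+ d =
    \sum_(k < d.+1) a k *: (w ^+ k * y ^+ (d - k)).
Proof.
move=> d0; pose v : 'rV[K]_d.+1 := \row_s (s : nat)%:R.
pose V := Vandermonde d.+1 v.
have Vu : V \in unitmx.
  rewrite unitmxE det_Vandermonde unitfE; apply/prodf_neq0 => i _.
  apply/prodf_neq0 => j ij; rewrite !mxE subr_eq0 eqr_nat.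
  by rewrite neq_ltn ij orbT.
pose u : 'cV[K]_d.+1 := \col_k (a k / 'C(d, k)%:R).
pose g := invmx V *m u.
have gE (k : 'I_d.+1) : \sum_(s < d.+1) (s : nat)%:R ^+ k * g s 0 = a k / 'C(d, k)%:R.
  have : (V *m g) k 0 = u k 0 by rewrite mulKVmx.
  by rewrite !mxE => <-; apply: eq_bigr => s _; rewrite !mxE.
exists (fun s => d.-root (g s 0)) => n y w.
under eq_bigr => s _ do rewrite exprZn rootCK // exprDn scaler_sumr.
rewrite exchange_big /=; apply: eq_bigr => k _.
under eq_bigr => s _ do
  rewrite exprZn -scalerAr scalerMnr scalerA (mulrC (g s 0)).
rewrite -scaler_suml gE -scaler_nat scalerA divfK ?(mulrC (w ^+ k)) //.
by rewrite pnatr_eq0 -lt0n bin_gt0 -ltnS.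
Qed.

(** * Sequences of polynomials *)

Lemma linForm_coefU (K : comNzRingType) n (a : 'rV[K]_n) j : (linForm a)@_U_(j) = a 0 j.
Proof.
rewrite /linForm raddf_sum (bigD1 j) //= big1 => [|i ij].
  by rewrite mcoeffZ mcoeffXU eqxx mulr1 addr0.
by rewrite mcoeffZ mcoeffXU (negPf ij) mulr0.
Qed.

Lemma linForm_is_linear (K : comNzRingType) n : linear (@linForm K n).
Proof.
move=> c a b; rewrite /linForm scaler_sumr -big_split; apply: eq_bigr => j _ /=.
by rewrite !mxE scalerDl scalerA.
Qed.

HB.instance Definition _ (K : comNzRingType) n :=
  GRing.isLinear.Build K 'rV[K]_n {mpoly K[n]} *:%R (@linForm K n) (@linForm_is_linear K n).

Section PolySequences.
Variables (U : ultrafilter) (K : numFieldType) (n : nat).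
Implicit Types (F G : nat -> {mpoly K[n]}).

Definition pbounded F := forall m, bounded U (fun k => (F k)@_m).
Definition pvanish F := forall m, vanish U (fun k => (F k)@_m).

Lemma pbounded_ae F G : U (fun k => F k = G k) -> pbounded F -> pbounded G.
Proof. by move=> e b m; apply: bounded_ae (b m); apply: largelyS e => k ->. Qed.

Lemma pbounded_ext F G : (forall k, F k = G k) -> pbounded F -> pbounded G.
Proof. by move=> e; apply: pbounded_ae; apply: largelyT. Qed.

Lemma pvanish_ae F G : U (fun k => F k = G k) -> pvanish F -> pvanish G.
Proof. by move=> e b m; apply: vanish_ae (b m); apply: largelyS e => k ->. Qed.

Lemma pvanish_ext F G : (forall k, F k = G k) -> pvanish F -> pvanish G.
Proof. by move=> e; apply: pvanish_ae; apply: largelyT. Qed.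

Lemma pbounded_cst p : pbounded (fun=> p).
Proof. by move=> m; exact: bounded_cst. Qed.

Lemma pvanish0 : pvanish (fun=> 0).
Proof. by move=> m; apply: vanish_ext (@vanish0 U K) => k; rewrite mcoeff0. Qed.

Lemma pbounded_vanish F : pvanish F -> pbounded F.
Proof. by move=> v m; exact: vanish_bounded. Qed.

Lemma pboundedD F G : pbounded F -> pbounded G -> pbounded (fun k => F k + G k).
Proof.
by move=> bF bG m; apply: bounded_ext (boundedD (bF m) (bG m)) => k; rewrite mcoeffD.
Qed.

Lemma pvanishD F G : pvanish F -> pvanish G -> pvanish (fun k => F k + G k).
Proof.
by move=> bF bG m; apply: vanish_ext (vanishD (bF m) (bG m)) => k; rewrite mcoeffD.
Qed.

Lemma pbounded_scale (c : nat -> K) F :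
  bounded U c -> pbounded F -> pbounded (fun k => c k *: F k).
Proof.
by move=> bc bF m; apply: bounded_ext (boundedM bc (bF m)) => k; rewrite mcoeffZ.
Qed.

Lemma pvanish_scale_bounded (c : nat -> K) F :
  bounded U c -> pvanish F -> pvanish (fun k => c k *: F k).
Proof.
by move=> bc vF m; apply: vanish_ext (vanishMl bc (vF m)) => k; rewrite mcoeffZ.
Qed.

Lemma pvanish_scale (c : nat -> K) F :
  vanish U c -> pbounded F -> pvanish (fun k => c k *: F k).
Proof.
by move=> vc bF m; apply: vanish_ext (vanishMr vc (bF m)) => k; rewrite mcoeffZ.
Qed.

Lemma pboundedN F : pbounded F -> pbounded (fun k => - F k).
Proof. by move=> b m; apply: bounded_ext (boundedN (b m)) => k; rewrite mcoeffN. Qed.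

Lemma pvanishN F : pvanish F -> pvanish (fun k => - F k).
Proof. by move=> b m; apply: vanish_ext (vanishN (b m)) => k; rewrite mcoeffN. Qed.

Lemma pboundedB F G : pbounded F -> pbounded G -> pbounded (fun k => F k - G k).
Proof. by move=> bF /pboundedN; exact: pboundedD. Qed.

Lemma pvanishB F G : pvanish F -> pvanish G -> pvanish (fun k => F k - G k).
Proof. by move=> bF /pvanishN; exact: pvanishD. Qed.

Lemma pboundedM F G : pbounded F -> pbounded G -> pbounded (fun k => F k * G k).
Proof.
move=> bF bG m; apply: (bounded_ext (fun k => esym (mcoeffM _ _ _))).
by apply: bounded_sum => i _; apply: boundedM.
Qed.

Lemma pvanishM F G : pvanish F -> pbounded G -> pvanish (fun k => F k * G k).
Proof.
move=> bF bG m; apply: (vanish_ext (fun k => esym (mcoeffM _ _ _))).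
by apply: vanish_sum => i _; apply: vanishMr.
Qed.

Lemma pboundedX F d : pbounded F -> pbounded (fun k => F k ^+ d).
Proof.
move=> bF; elim: d => [|d IH]; first exact: pbounded_cst.
by apply: pbounded_ext (pboundedM bF IH) => k; rewrite exprS.
Qed.

Lemma pbounded_sum (I : Type) (r : seq I) (F : I -> nat -> {mpoly K[n]}) :
  (forall i, pbounded (F i)) -> pbounded (fun k => \sum_(i <- r) F i k).
Proof.
move=> b m; apply: (bounded_ext (fun k => esym (raddf_sum (mcoeff m) _ _ _))).
by apply: bounded_sum => i _; exact: b.
Qed.

Lemma pvanish_sum (I : Type) (r : seq I) (F : I -> nat -> {mpoly K[n]}) :
  (forall i, pvanish (F i)) -> pvanish (fun k => \sum_(i <- r) F i k).
Proof.
move=> b m; apply: (vanish_ext (fun k => esym (raddf_sum (mcoeff m) _ _ _))).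
by apply: vanish_sum => i _; exact: b.
Qed.

Lemma pvanish_lim_bounded F p : pvanish (fun k => F k - p) -> pbounded F.
Proof.
move=> v; apply: pbounded_ext (pboundedD (pbounded_vanish v) (pbounded_cst p)) => k.
by rewrite subrK.
Qed.

Lemma pvanish_lim F p q :
  pvanish (fun k => F k - p) -> pvanish (fun k => F k - q) -> p = q.
Proof.
move=> vp vq; apply/mpolyP => m; apply: (vanish_lim (x := fun k => (F k)@_m)).
  by apply: vanish_ext (vp m) => k; rewrite mcoeffB.
by apply: vanish_ext (vq m) => k; rewrite mcoeffB.
Qed.

Lemma pvanish_limM F G p q : pvanish (fun k => F k - p) ->
  pvanish (fun k => G k - q) -> pvanish (fun k => F k * G k - p * q).
Proof.
move=> vF vG; have bG := pvanish_lim_bounded vG.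
apply: pvanish_ext (pvanishD (pvanishM vF bG) (pvanishM vG (pbounded_cst p))) => k.
by ring.
Qed.

Lemma pvanish_lim_prod (I : Type) (r : seq I) (F : I -> nat -> {mpoly K[n]}) p :
  (forall i, pvanish (fun k => F i k - p i)) ->
  pvanish (fun k => \prod_(i <- r) F i k - \prod_(i <- r) p i).
Proof.
move=> v; elim: r => [|i r IH].
  by apply: pvanish_ext pvanish0 => k; rewrite !big_nil subrr.
by apply: pvanish_ext (pvanish_limM (v i) IH) => k; rewrite !big_cons.
Qed.

Lemma pvanish_limX F p d : pvanish (fun k => F k - p) ->
  pvanish (fun k => F k ^+ d - p ^+ d).
Proof.
move=> v; elim: d => [|d IH].
  by apply: pvanish_ext pvanish0 => k; rewrite subrr.
by apply: pvanish_ext (pvanish_limM v IH) => k; rewrite !exprS.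
Qed.

Lemma pbounded_linForm (a : nat -> 'rV[K]_n) :
  (forall j, bounded U (fun k => a k 0 j)) -> pbounded (fun k => linForm (a k)).
Proof.
by move=> b; apply: pbounded_sum => j; apply: pbounded_scale => //; exact: pbounded_cst.
Qed.

Lemma pvanish_linForm (a : nat -> 'rV[K]_n) (c : 'rV[K]_n) :
  (forall j, vanish U (fun k => a k 0 j - c 0 j)) ->
  pvanish (fun k => linForm (a k) - linForm c).
Proof.
move=> v; apply: (@pvanish_ext (fun k => \sum_j (a k 0 j - c 0 j) *: 'X_j)).
  by move=> k; rewrite -sumrB; apply: eq_bigr => j _; rewrite scalerBl.
by apply: pvanish_sum => j; apply: pvanish_scale => //; exact: pbounded_cst.
Qed.

End PolySequences.

Section ProductLimits.
Variables (R : realType) (U : ultrafilter).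
Local Notation C := R[i].

Lemma max_coordinate n (a : 'rV[C]_n.+1) :
  exists j, forall i, `|a 0 i| <= `|a 0 j|.
Proof.
have /= [j _ hj] := @arg_maxP _ _ 'I_n.+1 ord0 predT (fun i => complex.Re `|a 0 i|) isT.
by exists j => i; rewrite [X in X <= _]normc_Re [X in _ <= X]normc_Re lecR; apply: hj.
Qed.

Lemma row_normalise n (a : 'rV[C]_n.+1) : exists lu : C * 'rV[C]_n.+1,
  [/\ a = lu.1 *: lu.2, forall j, `|lu.2 0 j| <= 1 & exists j, lu.2 0 j = 1].
Proof.
have [j hj] := max_coordinate a.
have [a0|aj] := eqVneq (a 0 j) 0.
  (* The zero row also gets a normalised direction, so that every limit direction is nonzero. *)
  exists (0, const_mx 1); split=> [|i|]; last by exists j; rewrite mxE.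
    apply/rowP => i; rewrite !mxE mul0r; apply/eqP; rewrite -normr_le0.
    by apply: le_trans (hj i) _; rewrite a0 normr0.
  by rewrite mxE normr1.
exists (a 0 j, (a 0 j)^-1 *: a); split=> [|i|].
- by rewrite scalerA mulfV // scale1r.
- by rewrite mxE normrM normfV mulrC ler_pdivrMr ?mul1r ?normr_gt0.
by exists j; rewrite mxE mulVf.
Qed.

(* Normalise the factors: their limits have a nonzero product, so that the
   normalising constants stay bounded. *)
Lemma prod_linForm_limit n d (a : 'I_d.+1 -> nat -> 'rV[C]_n.+1) :
  pbounded U (fun k => \prod_i linForm (a i k)) ->
  exists L : 'I_d.+1 -> 'rV[C]_n.+1,
    pvanish U (fun k => \prod_i linForm (a i k) - \prod_i linForm (L i)).
Proof.
move=> ba; have [lu hlu] := choice (fun ik : 'I_d.+1 * nat => row_normalise (a ik.1 ik.2)).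
pose lam i k := (lu (i, k)).1; pose u i k := (lu (i, k)).2.
have aE i k : a i k = lam i k *: u i k by case: (hlu (i, k)).
have bu i j : bounded U (fun k => u i k 0 j).
  by exists 1; apply: largelyT => k; case: (hlu (i, k)).
have [v hv] := choice (fun ij : 'I_d.+1 * 'I_n.+1 => standard_part (bu ij.1 ij.2)).
pose w i : 'rV[C]_n.+1 := \row_j v (i, j).
have uw i : pvanish U (fun k => linForm (u i k) - linForm (w i)).
  by apply: pvanish_linForm => j; rewrite mxE; exact: (hv (i, j)).
have w0 i : linForm (w i) != 0.
  have [j hj] : exists j, U (fun k => u i k 0 j = 1).
    by apply: largely_exists; apply: largelyT => k; case: (hlu (i, k)).
  have wj : w i 0 j = 1.
    apply: (vanish_lim (U := U) (x := fun k => u i k 0 j)).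
      by rewrite mxE; exact: (hv (i, j)).
    by apply: vanish_ae (@vanish0 U C); apply: largelyS hj => k ->; rewrite subrr.
  apply/eqP => /(congr1 (mcoeff U_(j)%MM)); rewrite linForm_coefU wj mcoeff0 => /eqP.
  by rewrite oner_eq0.
pose c k := \prod_i lam i k.
have prodE k : \prod_i linForm (a i k) = c k *: \prod_i linForm (u i k).
  by rewrite -scaler_prod; apply: eq_bigr => i _; rewrite aE linearZ.
have vp := pvanish_lim_prod (index_enum 'I_d.+1) uw.
have [m pm] : exists m, (\prod_i linForm (w i))@_m != 0.
  exists (mlead (\prod_i linForm (w i))); rewrite mleadc_eq0.
  by apply/prodf_neq0 => i _.
have bc : bounded U c.
  apply: contrapT => nb; move/eqP: pm; apply.
  apply: (vanish_lim (U := U) (x := fun k => (\prod_i linForm (u i k))@_m)).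
    by apply: vanish_ext (vp m) => k; rewrite mcoeffB.
  apply: vanish_ae (vanishMr (vanish_inv nb) (ba m)).
  apply: largelyS (not_bounded_neq0 nb) => k ck.
  by rewrite prodE mcoeffZ mulKf // subr0.
have [c' hc'] := standard_part bc.
exists (fun i => (if i == ord0 then c' else 1) *: w i).
have -> : \prod_i linForm ((if i == ord0 then c' else 1) *: w i) =
    c' *: \prod_i linForm (w i).
  have -> : c' = \prod_(i < d.+1) (if i == ord0 then c' else 1).
    by rewrite -big_mkcond big_pred1_eq.
  by rewrite -scaler_prod; apply: eq_bigr => i _; rewrite linearZ -big_mkcond big_pred1_eq.
have v1 := pvanish_scale_bounded bc vp.
have v2 := pvanish_scale hc' (pbounded_cst U (\prod_i linForm (w i))).
apply: pvanish_ext (pvanishD v1 v2) => k.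
by rewrite prodE scalerBr scalerBl addrA subrK.
Qed.

End ProductLimits.

(** * Limits of products plus powers *)

Section PartialDegree.
Variables (K : comNzRingType) (n : nat) (j0 : 'I_n).
Implicit Types (p q : {mpoly K[n]}).

Definition deg_le e p := forall m : 'X_{1..n}, (e < m j0)%N -> p@_m = 0.

Lemma deg_leD e p q : deg_le e p -> deg_le e q -> deg_le e (p + q).
Proof. by move=> hp hq m em; rewrite mcoeffD hp // hq // addr0. Qed.

Lemma deg_leM a b p q : deg_le a p -> deg_le b q -> deg_le (a + b) (p * q).
Proof.
move=> hp hq m abm; rewrite mcoeffM big1 // => -[k1 k2] /= /eqP mE.
have [ak|ka] := ltnP a (bmnm k1 j0); first by rewrite hp ?mul0r.
rewrite hq ?mulr0 //; have /= := congr1 (fun m' : 'X_{1..n} => m' j0) mE.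
by rewrite mnmDE; move: (m j0) (bmnm k1 j0) (bmnm k2 j0) abm ka => x y z; lia.
Qed.

Lemma deg_leW a b p : (a <= b)%N -> deg_le a p -> deg_le b p.
Proof. by move=> ab h m bm; apply: h; apply: leq_ltn_trans bm. Qed.

Lemma deg_leC e c : deg_le e c%:MP.
Proof.
move=> m em; rewrite mcoeffC; case: eqP => [m0|]; last by rewrite mulr0.
by move: em; rewrite m0 mnm0E.
Qed.

Lemma deg_leZ e c p : deg_le e p -> deg_le e (c *: p).
Proof. by move=> h m em; rewrite mcoeffZ h // mulr0. Qed.

Lemma deg_leX (j : 'I_n) : deg_le (j == j0) 'X_j.
Proof.
move=> m em; rewrite mcoeffX; case: eqP => // mE.
by move: em; rewrite -mE mnm1E ltnn.
Qed.

Lemma deg_le_linForm (a : 'rV[K]_n) : a 0 j0 = 0 -> deg_le 0 (linForm a).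
Proof.
move=> a0 m em; rewrite /linForm raddf_sum big1 // => j _ /=; rewrite mcoeffZ.
have [->|jj] := eqVneq j j0; first by rewrite a0 mul0r.
by rewrite deg_leX ?mulr0 // (negPf jj).
Qed.

Lemma deg_le_esym (s : seq {mpoly K[n]}) l :
  (forall w, w \in s -> deg_le 0 w) -> deg_le 0 (esym_poly s)`_l.
Proof.
elim: s l => [|w s IH] l h.
  rewrite /esym_poly big_nil coef1; case: eqP => _; rewrite -?mpolyC1 -?mpolyC0.
    exact: deg_leC.
  exact: deg_leC.
have hs l' : deg_le 0 (esym_poly s)`_l' by apply: IH => x xs; apply: h; rewrite inE xs orbT.
rewrite esym_poly_cons; apply: deg_leD => //; apply: (@deg_leM 0 0).
  by apply: h; rewrite mem_head.
by case: l => [|l]; rewrite -?mpolyC0 //; exact: deg_leC.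
Qed.

Lemma deg_le_exp e p : deg_le 1 p -> deg_le e (p ^+ e).
Proof.
move=> h; elim: e => [|e IH]; first by rewrite expr0 -mpolyC1; exact: deg_leC.
by rewrite exprS -add1n; apply: deg_leM.
Qed.

(** Over the polynomials in the other variables, the power is monic of degree e in x_(j0), so [p] is
    the leading coefficient of the product. *)
Lemma mcoeff_mul_exp p eta e m : deg_le 0 p -> deg_le 0 eta ->
  (p * ('X_j0 + eta) ^+ e)@_(m + U_(j0) *+ e)%MM = p@_m.
Proof.
move=> hp heta; elim: e p hp => [|e IH] p hp.
  by rewrite expr0 mulr1 mulm0n addm0.
have hY : deg_le 1 ('X_j0 + eta).
  by apply: deg_leD; [have := @deg_leX j0; rewrite eqxx|apply: deg_leW heta].
rewrite exprS mulrA mulrDr mulrDl mcoeffD [X in _ + X](_ : _ = 0); last first.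
  have h := deg_leM (deg_leM hp heta) (@deg_le_exp e _ hY).
  by apply: h; rewrite mnmDE mulmnE mnm1E eqxx; lia.
rewrite addr0 -mulrA (mulrC 'X_j0) mulrA mulmSr addmA.
by rewrite addmC mcoeffMX IH.
Qed.

End PartialDegree.

Lemma meval_delta (K : comNzRingType) n (p : {mpoly K[n]}) d j0 : p \is d.-homog ->
  p.@[fun j => (j == j0)%:R] = p@_(U_(j0) *+ d)%MM.
Proof.
move=> /dhomogP hp; rewrite mevalE [in RHS](mpolyE p) raddf_sum !big_seq.
apply: eq_bigr => m ms /=; rewrite mcoeffZ mcoeffX; congr (_ * _).
have [->|mn] := eqVneq m (U_(j0) *+ d)%MM.
  rewrite big1 // => i _; rewrite mulmnE mnm1E eq_sym.
  by case: eqP => _; rewrite ?mul1n ?expr1n // mul0n expr0.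
have [i [ij mi]] : exists i, i != j0 /\ m i != 0%N.
  apply: contrapT => h; move/eqP: mn; apply; apply/mnmP => i.
  have m0 i' : i' != j0 -> m i' = 0%N.
    by move=> ij; apply/eqP; apply: contrapT => /negP mi; apply: h; exists i'.
  have md := hp _ ms; rewrite /= mdegE (bigD1 j0) //= big1 ?addn0 // in md.
  rewrite mulmnE mnm1E; case: eqP => [<-|/eqP ij]; first by rewrite mul1n.
  by rewrite mul0n m0 // eq_sym.
by rewrite (bigD1 i) //= (negPf ij) expr0n (negPf mi) mul0r.
Qed.

Lemma linSubst_prodPlusPower (K : comNzRingType) n d (A : 'M[K]_(d.+1, n)) :
  linSubst A (prodPlusPower K d) =
  \prod_(i < d) linForm (row (widen_ord (leqnSn d) i) A) + linForm (row ord_max A) ^+ d.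
Proof.
rewrite /linSubst /prodPlusPower rmorphD rmorph_prod rmorphXn /=; congr (_ + _ ^+ _).
  by apply: eq_bigr => i _; rewrite comp_mpolyXU -tnth_nth tnth_mktuple.
by rewrite comp_mpolyXU -tnth_nth tnth_mktuple.
Qed.

(** * Limits with bounded y *)

Section BoundedCase.
Variables (R : realType) (U : ultrafilter) (n d : nat).
Local Notation C := R[i].
Variables (A : nat -> 'M[C]_(d.+2, n.+1)) (f : {mpoly C[n.+1]}).
Hypothesis limA : pvanish U (fun k => linSubst (A k) (prodPlusPower C d.+1) - f).

Lemma projection_of_bounded :
  (forall j, bounded U (fun k => A k ord_max j)) ->
  isProjection f (prodPlusPower C d.+1).
Proof.
move=> bA; have [y hy] := choice (fun j => standard_part (bA j)).
have vy : pvanish U (fun k => linForm (row ord_max (A k)) ^+ d.+1 -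
                              linForm (\row_j y j) ^+ d.+1).
  by apply: pvanish_limX; apply: pvanish_linForm => j; apply: vanish_ext (hy j) => k; rewrite !mxE.
have bF := pvanish_lim_bounded limA.
have [|L vL] := @prod_linForm_limit R U n d
    (fun i k => row (widen_ord (leqnSn d.+1) i) (A k)).
  apply: pbounded_ext (pboundedB bF (pvanish_lim_bounded vy)) => k.
  by rewrite linSubst_prodPlusPower addrK.
pose B : 'M[C]_(d.+2, n.+1) := \matrix_(i, j)
  if unlift ord_max i is Some i' then L i' 0 j else y j.
exists B; apply: (pvanish_lim limA); rewrite linSubst_prodPlusPower.
have -> : row ord_max B = \row_j y j.
  by apply/rowP => j; rewrite !mxE unlift_none.
have -> : \prod_i linForm (row (widen_ord (leqnSn d.+1) i) B) = \prod_i linForm (L i).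
  apply: eq_bigr => i _; congr linForm; apply/rowP => j; rewrite !mxE.
  have -> : widen_ord (leqnSn d.+1) i = lift ord_max i.
    by apply: val_inj; rewrite /= /bump leqNgt ltn_ord.
  by rewrite liftK.
apply: pvanish_ext (pvanishD vL vy) => k.
by rewrite linSubst_prodPlusPower opprD addrACA.
Qed.

End BoundedCase.

Section PowerSums.
Variables (U : ultrafilter) (K : numFieldType) (n : nat).

(** The system is triangular in the degree in x_(j0): at degree D-l the terms after l contribute
    nothing, those before l are bounded by induction, and the l-th contributes exactly [G l]. *)
Lemma pbounded_coefficients j0 D (G : nat -> nat -> {mpoly K[n]})
    (eta : nat -> {mpoly K[n]}) :
  (forall l k, deg_le j0 0 (G l k)) -> (forall k, deg_le j0 0 (eta k)) ->
  pbounded U eta ->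
  pbounded U (fun k => \sum_(l < D.+1) G l k * ('X_j0 + eta k) ^+ (D - l)) ->
  forall l, (l <= D)%N -> pbounded U (G l).
Proof.
move=> hG heta beta bF; elim/ltn_ind => l IH lD m.
have [m0|m0] := posnP (m j0); last first.
  by apply: bounded_ext (bounded_cst U 0) => k; rewrite hG.
have hY k : deg_le j0 1 ('X_j0 + eta k).
  by apply: deg_leD; [have := @deg_leX K _ j0 j0; rewrite eqxx|apply: deg_leW (heta k)].
pose m' := (m + U_(j0) *+ (D - l))%MM.
have m'j : m' j0 = (D - l)%N by rewrite mnmDE m0 mulmnE mnm1E eqxx mul1n.
pose S k := \sum_(i < l) (G i k * ('X_j0 + eta k) ^+ (D - i))@_m'.
have bS : bounded U S.
  apply: bounded_sum => i _; have bG := IH i (ltn_ord i) (ltnW (leq_trans (ltn_ord i) lD)).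
  exact: (pboundedM bG (pboundedX (D - i) (pboundedD (pbounded_cst U _) beta))).
apply: bounded_ext (boundedB (bF m') bS) => k.
rewrite raddf_sum /= -(big_mkord predT (fun i => (G i k * ('X_j0 + eta k) ^+ (D - i))@_m')).
rewrite (big_cat_nat _ (n := l)) //=; last by rewrite ltnW.
rewrite big_mkord -/(S k) addrAC subrr add0r big_ltn // mcoeff_mul_exp //.
rewrite big_nat big1 ?addr0 // => i /andP[li iD].
have h := deg_leM (hG i k) (@deg_le_exp _ _ _ (D - i) _ (hY k)).
by apply: h; rewrite m'j add0n; lia.
Qed.

(** In Newton's identity times B, a mixed term B e_i p_(l-i) equals B^-1 (B e_i) (B p_(l-i)). Both
    brackets are bounded, the second by induction, and B^-1 tends to 0; so only the terms in e_l and
    p_l survive. *)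
Lemma power_sums_of_esym D (s : nat -> seq {mpoly K[n]}) (B : nat -> K) :
  ~ bounded U B ->
  (forall l, (0 < l <= D)%N -> pbounded U (fun k => B k *: (esym_poly (s k))`_l)) ->
  forall l, (0 < l <= D)%N ->
  pvanish U (fun k => B k *: (\sum_(w <- s k) w ^+ l) -
    ((-1) ^+ l.-1 *+ l) *: (B k *: (esym_poly (s k))`_l)).
Proof.
move=> nB be; elim/ltn_ind => -[//|l] IH lD.
have bp i : (0 < i <= l)%N -> pbounded U (fun k => B k *: (\sum_(w <- s k) w ^+ i)).
  move=> /andP[i0 il]; have iD : (0 < i <= D)%N by rewrite i0 (leq_trans il) // ltnW.
  have v := IH i _ iD; move/(_ il): v => /pbounded_vanish b.
  have := pboundedD b (pbounded_scale (bounded_cst U ((-1) ^+ i.-1 *+ i)) (be i iD)).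
  by apply: pbounded_ext => k; rewrite subrK.
pose rest k := \sum_(i < l) ((-1) ^+ (l - i).-1 : K) *:
  ((B k)^-1 *: ((B k *: (esym_poly (s k))`_i.+1) *
                (B k *: (\sum_(w <- s k) w ^+ (l - i))))).
have vrest : pvanish U rest.
  apply: pvanish_sum => i; apply: pvanish_scale_bounded (bounded_cst _ _) _.
  apply: pvanish_scale (vanish_inv nB) _; apply: pboundedM.
    apply: be; rewrite /=; apply: leq_trans (ltn_ord i) _; apply: ltnW.
    by case/andP: lD.
  by apply: bp; rewrite subn_gt0 ltn_ord leq_subr.
apply: pvanish_ae (pvanish_scale_bounded (bounded_cst U (- (-1) ^+ l)) vrest).
apply: largelyS (not_bounded_neq0 nB) => k B0.
have sgn a (x : {mpoly K[n]}) : ((-1) ^+ a : K) *: x = (-1) ^+ a * x.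
  by rewrite -signr_odd scaler_sign -[in RHS]signr_odd mulr_sign.
have restE : rest k = B k *: \sum_(i < l) (esym_poly (s k))`_i.+1 *
    ((-1) ^+ (l - i).-1 * \sum_(w <- s k) w ^+ (l - i)).
  rewrite /rest scaler_sumr; apply: eq_bigr => i _.
  rewrite -scalerAl -scalerAr (scalerA (B k)^-1) mulVf // scale1r sgn.
  by rewrite (mulrCA _ ((-1) ^+ _)) !scalerAr.
have nid : (esym_poly (s k))`_l.+1 *+ l.+1 =
    (-1) ^+ l * (\sum_(w <- s k) w ^+ l.+1) +
    \sum_(i < l) (esym_poly (s k))`_i.+1 *
      ((-1) ^+ (l - i).-1 * \sum_(w <- s k) w ^+ (l - i)).
  rewrite newton_identity // big_ord_recl subn0 esym_poly_coef0 mul1r; congr (_ + _).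
rewrite restE /= -(mulr_natr _ l.+1) -scalerA (scalerA l.+1%:R) (mulrC l.+1%:R).
rewrite -scalerA scaler_nat nid -sgn !scalerDr !scalerA.
rewrite (mulrC _ ((-1) ^+ l)) mulrA -expr2 sqrr_sign mul1r.
by rewrite opprD addrA subrr sub0r mulNr scaleNr.
Qed.

End PowerSums.

Lemma dhomog_linSubst_prodPlusPower (K : comNzRingType) n d (A : 'M[K]_(d.+1, n)) :
  linSubst A (prodPlusPower K d) \is d.-homog.
Proof.
rewrite linSubst_prodPlusPower; apply: dhomogD.
  have h e (a : 'I_e -> 'rV[K]_n) : \prod_i linForm (a i) \is e.-homog.
    elim: e a => [|e IH] a; first by rewrite big_ord0 dhomog1.
    rewrite big_ord_recl.
    by have := dhomogM (dhomog_linForm (a ord0)) (IH (fun i => a (lift ord0 i))); rewrite add1n.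
  exact: h.
by have := dhomogMn d (dhomog_linForm (row ord_max A)); rewrite mul1n.
Qed.

Lemma sum_powers_mxvec (K : comNzRingType) n d r1 r2 (L : 'M[K]_(r1 * r2, n)) :
  sum_powers d L = \sum_(i < r1) \sum_(t < r2) linForm (row (mxvec_index i t) L) ^+ d.
Proof.
rewrite pair_bigA /= /sum_powers (reindex _ (curry_mxvec_bij _ _)).
by apply: eq_bigr => -[i t] _.
Qed.

(** * Limits with unbounded y *)

Section UnboundedCase.
Variables (R : realType) (U : ultrafilter) (n d : nat).
Local Notation C := R[i].
Variables (A : nat -> 'M[C]_(d.+2, n.+1)) (f : {mpoly C[n.+1]}).
Hypothesis limA : pvanish U (fun k => linSubst (A k) (prodPlusPower C d.+1) - f).
Local Notation D := d.+1.

Lemma waring_of_unbounded :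
  ~ (forall j, bounded U (fun k => A k ord_max j)) ->
  exists L : nat -> 'M[C]_(D * D.+1, n.+1),
    pvanish U (fun k => sum_powers D (L k) - f).
Proof.
move=> nb; pose wd i := widen_ord (leqnSn D) i.
have [j0 hj0] : exists j0, U (fun k => forall j, `|A k ord_max j| <= `|A k ord_max j0|).
  apply: largely_exists; apply: largelyT => k.
  have [j hj] := max_coordinate (row ord_max (A k)).
  by exists j => i; have := hj i; rewrite !mxE.
pose beta k := A k ord_max j0; pose b i k := A k (wd i) j0.
have nbeta : ~ bounded U beta.
  by move=> bb; apply: nb => j; apply: bounded_le bb; apply: largelyS hj0 => k.
pose B k := \prod_(i < D) b i k.
have bF := pvanish_lim_bounded limA.
have linE (a : 'rV[C]_n.+1) : (linForm a).@[fun j => (j == j0)%:R] = a 0 j0.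
  rewrite (@meval_delta _ _ _ 1) ?mulm1n ?linForm_coefU //; exact: dhomog_linForm.
have nB : ~ bounded U B.
  move=> bB; apply: nbeta; apply: (@bounded_of_pow _ _ _ D) => //.
  have b1 : bounded U (fun k => B k + beta k ^+ D).
    apply: bounded_ext (bF (U_(j0) *+ D)%MM) => k.
    rewrite -meval_delta; last exact: dhomog_linSubst_prodPlusPower.
    rewrite linSubst_prodPlusPower mevalD rmorph_prod rmorphXn /= linE !mxE.
    by congr (_ + _); apply: eq_bigr => i _; rewrite linE !mxE.
  by apply: bounded_ext (boundedB b1 bB) => k; rewrite addrC addKr.
(* The entries at [j0] are prescribed, so that Y has coefficient 1 at x_(j0) and eta, w are free of
   it for every k, even where a denominator is 0. *)
pose yh k : 'rV[C]_n.+1 := \row_j if j == j0 then 1 else A k ord_max j / beta k.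
pose eta k : 'rV[C]_n.+1 := \row_j if j == j0 then 0 else A k ord_max j / beta k.
pose w i k : 'rV[C]_n.+1 :=
  \row_j if j == j0 then 0 else A k (wd i) j / b i k - yh k 0 j.
pose Y k := linForm (yh k); pose W i k := linForm (w i k).
have YE k : Y k = 'X_j0 + linForm (eta k).
  rewrite /Y; have -> : yh k = delta_mx 0 j0 + eta k.
    by apply/rowP => j; rewrite !mxE; case: eqP; rewrite ?addr0 ?add0r.
  rewrite linearD; congr (_ + _); rewrite /= /linForm (bigD1 j0) //= big1 => [|j jj].
    by rewrite mxE !eqxx scale1r addr0.
  by rewrite mxE (negPf jj) andbF scale0r.
have eta0 k : deg_le j0 0 (linForm (eta k)) by apply: deg_le_linForm; rewrite mxE eqxx.
have W0 i k : deg_le j0 0 (W i k) by apply: deg_le_linForm; rewrite mxE eqxx.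
have beta_eta : pbounded U (fun k => linForm (eta k)).
  apply: pbounded_linForm => j; exists 1; apply: largelyS hj0 => k /(_ j) h.
  rewrite mxE; case: eqP => _; first by rewrite normr0.
  have [b0|b0] := eqVneq (beta k) 0; first by rewrite b0 invr0 mulr0 normr0.
  by rewrite normrM normfV ler_pdivrMr ?mul1r ?normr_gt0.
have bY : pbounded U Y.
  by apply: pbounded_ext (pboundedD (pbounded_cst U 'X_j0) beta_eta) => k; rewrite YE.
pose s k := [seq W i k | i <- enum 'I_D].
have ss k : size (s k) = D by rewrite size_map size_enum_ord.
have sumS k (g : {mpoly C[n.+1]} -> {mpoly C[n.+1]}) :
    \sum_(x <- s k) g x = \sum_i g (W i k) by rewrite big_map big_enum.
(* The power y^D is beta^D Y^D and joins the term l = 0; it is the sum B + beta^D that stays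
   bounded, not B. *)
pose G l k : {mpoly C[n.+1]} :=
  if l == 0%N then (B k + beta k ^+ D)%:MP else B k *: (esym_poly (s k))`_l.
have G0 l k : deg_le j0 0 (G l k).
  rewrite /G; case: eqP => _; first exact: deg_leC.
  by apply: deg_leZ; apply: deg_le_esym => x /mapP[i _ ->].
have FG : U (fun k => linSubst (A k) (prodPlusPower C D) =
                     \sum_(l < D.+1) G l k * Y k ^+ (D - l)).
  apply: largelyS2 (not_bounded_neq0 nB) (not_bounded_neq0 nbeta) => k B0 b0.
  have bi0 i : b i k != 0 by move: B0 => /prodf_neq0; apply.
  rewrite linSubst_prodPlusPower.
  have -> : row ord_max (A k) = beta k *: yh k.
    apply/rowP => j; rewrite !mxE; case: eqP => [->|_]; first by rewrite mulr1.
    by rewrite mulrC divfK.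
  have rowE i : row (wd i) (A k) = b i k *: (yh k + w i k).
    apply/rowP => j; rewrite !mxE; case: eqP => [->|_]; first by rewrite addr0 mulr1.
    by rewrite addrC subrK mulrC divfK.
  have -> : \prod_(i < D) linForm (row (wd i) (A k)) = B k *: \prod_(x <- s k) (Y k + x).
    rewrite big_map big_enum -scaler_prod; apply: eq_bigr => i _.
    by rewrite rowE linearZ linearD.
  rewrite linearZ exprZn prod_shift_esym ss scaler_sumr.
  rewrite big_ord_recl [in RHS]big_ord_recl /= esym_poly_coef0 mul1r subn0 /G eqxx addrAC mul_mpolyC scalerDl.
  by congr (_ + _); apply: eq_bigr => l _; rewrite /= scalerAl.
have bG l : (l <= D)%N -> pbounded U (G l).
  move=> lD; apply: (pbounded_coefficients G0 eta0 beta_eta _ lD).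
  apply: pbounded_ext (pbounded_ae FG bF) => k.
  by apply: eq_bigr => i _; rewrite YE.
have ps l : (0 < l <= D)%N -> pvanish U (fun k => B k *: (\sum_(x <- s k) x ^+ l) -
    ((-1) ^+ l.-1 *+ l) *: (B k *: (esym_poly (s k))`_l)).
  apply: (power_sums_of_esym nB) => l' /andP[l0 lD].
  by apply: pbounded_ext (bG _ lD) => k; rewrite /G -[l' == _]negbK -lt0n l0.
(* Chosen so that [a k l] times the l-th power sum is asymptotic to [G l k]: the power sum of order
   0 is D, and for l > 0 the ratio (-1)^(l-1) l of [ps] is inverted. *)
pose a k l : C := if l == 0%N then (B k + beta k ^+ D) / D%:R
                  else B k * ((-1) ^+ l.-1 / l%:R).
have [c hc] := choice (fun k => binary_waring (a k) (ltn0Sn d)).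
pose Lr k : 'rV['rV[C]_n.+1]_(D * D.+1) := mxvec (\matrix_(i < D, t < D.+1)
  (c k t *: (yh k + (t : nat)%:R *: w i k))).
pose L k : 'M[C]_(D * D.+1, n.+1) := \matrix_(p, j) Lr k 0 p 0 j.
have LE k : sum_powers D (L k) =
    \sum_(l < D.+1) (a k l *: \sum_(x <- s k) x ^+ l) * Y k ^+ (D - l).
  rewrite sum_powers_mxvec.
  transitivity (\sum_(i < D) \sum_(l < D.+1) a k l *: (W i k ^+ l * Y k ^+ (D - l))).
    apply: eq_bigr => i _; rewrite -hc; apply: eq_bigr => t _; congr (_ ^+ _).
    have -> : row (mxvec_index i t) (L k) = c k t *: (yh k + (t : nat)%:R *: w i k).
      by apply/rowP => j; rewrite mxE /L mxE /Lr mxvecE mxE.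
    by rewrite linearZ linearD linearZ.
  rewrite exchange_big; apply: eq_bigr => l _ /=.
  rewrite -scalerAl sumS mulr_suml scaler_sumr; apply: eq_bigr => i _ //.
exists L.
have vG l : (l <= D)%N ->
    pvanish U (fun k => G l k - a k l *: \sum_(x <- s k) x ^+ l).
  case: l => [|l] lD.
    apply: pvanish_ext (@pvanish0 U C n.+1) => k; rewrite /G /a /= sumS.
    rewrite (eq_bigr (fun=> 1)) => [|i _]; last by rewrite expr0.
    rewrite sumr_const card_ord -scalerMnr scalerMnl -mulr_natr divfK ?pnatr_eq0 //.
    by rewrite alg_mpolyC subrr.
  apply: pvanish_ext (pvanish_scale_bounded
    (bounded_cst U (- ((-1) ^+ l / l.+1%:R))) (ps l.+1 lD)) => k.
  have key : (-1) ^+ l / l.+1%:R * ((-1) ^+ l *+ l.+1) = 1 :> C.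
    rewrite -(mulr_natr (_ ^+ _)) mulrACA mulVf ?pnatr_eq0 // mulr1.
    by rewrite -expr2 sqrr_sign.
  rewrite /G /a /= scalerBr (scalerA _ (_ *+ _)) mulNr key scaleN1r opprK addrC.
  by rewrite scaleNr scalerA mulrC.
have v1 : pvanish U (fun k => \sum_(l < D.+1)
    (G l k - a k l *: \sum_(x <- s k) x ^+ l) * Y k ^+ (D - l)).
  apply: pvanish_sum => l; apply: pvanishM (pboundedX _ bY).
  by apply: vG; rewrite -ltnS.
apply: pvanish_ae (pvanishB limA v1); apply: largelyS FG => k ->.
rewrite LE -[X in _ - _ - X]/(\sum_(l < D.+1) _).
under [X in _ - _ - X]eq_bigr do rewrite mulrBl.
by rewrite sumrB opprB addrC addrA subrK.
Qed.

End UnboundedCase.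

(** * Passing between closures and sequences *)

Section Closure.
Variable R : realType.
Local Notation C := R[i].

Lemma border_projection_sequence n N (f : {mpoly C[n]}) (g : {mpoly C[N]}) U :
  isBorderProjection f g ->
  exists A : nat -> 'M[C]_(N, n), pvanish U (fun k => linSubst (A k) g - f).
Proof.
move=> hf; have e0 k : 0 < (k.+1%:R^-1 : R) by rewrite invr_gt0 ltr0n.
have [A hA] := choice (fun k => hf _ (e0 k)).
exists A => m; apply: vanish_le (vanish_complex (@vanish_harmonic R U)).
apply: largelyT => k; rewrite mcoeffB [X in _ <= X]ger0_norm; first exact/ltW/hA.
by rewrite lecR ltW.
Qed.

(** For the degenerate cases d = 0 and n = 0, where the set of all g(Ax) is a single point and hence
    closed. *)
Lemma border_projection_cst n N (f : {mpoly C[n]}) (g : {mpoly C[N]}) :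
  (forall A B : 'M[C]_(N, n), linSubst A g = linSubst B g) ->
  isBorderProjection f g -> isProjection f g.
Proof.
move=> cst hf; have [U] := ultrafilter_exists.
have [A vA] := border_projection_sequence U hf; exists (A 0%N).
apply: (pvanish_lim vA); apply: pvanish_ext (@pvanish0 U C n) => k.
by rewrite (cst _ (A 0%N)) subrr.
Qed.

(** Coefficientwise convergence becomes uniform because homogeneity leaves finitely many monomials
    to control. *)
Lemma border_waring_of_limit U n d r (f : {mpoly C[n]}) (L : nat -> 'M[C]_(r, n)) :
  f \is d.-homog -> pvanish U (fun k => sum_powers d (L k) - f) ->
  hasBorderWaring d f r.
Proof.
move=> hf vL; apply: border_waring_of_closure => // e e0.
have /largely_ex[k hk] : U (fun k => forall m : 'X_{1..n < d.+1},
    `|(sum_powers d (L k) - f)@_m| < e).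
  by apply: largely_all => m; exact: vL.
exists (L k) => m; rewrite -mcoeffB.
have [md|md] := ltnP (mdeg m) d.+1; first exact: hk (BMultinom md).
have md' : mdeg m != d by rewrite neq_ltn md orbT.
rewrite mcoeffB (dhomog_nemf_coeff (dhomog_sum_powers _ _) md').
by rewrite (dhomog_nemf_coeff hf md') subrr normr0.
Qed.

Lemma border_waring_rank_exists n d r (f : {mpoly C[n]}) :
  hasBorderWaring d f r -> exists2 s, isBorderWaringRank d f s & (s <= r)%N.
Proof.
move=> hr; have ex : exists s, `[< hasBorderWaring d f s >] by exists r; apply/asboolP.
exists (ex_minn ex); case: ex_minnP => s /asboolP hs smin.
  by split=> // s' hs'; apply: smin; apply/asboolP.
by apply: smin; apply/asboolP.
Qed.

End Closure.

Theorem mainTheorem6 (R : realType) :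
  exists C : nat,
    forall (d n : nat) (f : {mpoly R[i][n]}),
      f \is d.-homog ->
      isBorderProjection f (prodPlusPower R[i] d) ->
      isProjection f (prodPlusPower R[i] d) \/
      exists2 r : nat, isBorderWaringRank d f r & (r <= C * d ^ 5)%N.
Proof.
(* The number of powers is d(d+1), at most 2 d^2 and so at most 2 d^5 for d > 0. *)
exists 2%N => d n f hf hb.
case: d hf hb => [|d] hf hb.
  left; apply: border_projection_cst hb => A B.
  by rewrite !linSubst_prodPlusPower !big_ord0 !expr0.
case: n f hf hb => [|n] f hf hb.
  by left; apply: border_projection_cst hb => A B; rewrite (thinmx0 A) (thinmx0 B).
have [U] := ultrafilter_exists.
have [A vA] := border_projection_sequence U hb.
have [bA|nA] := pselect (forall j, bounded U (fun k => A k ord_max j)).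
  by left; apply: projection_of_bounded vA bA.
right; have [L vL] := waring_of_unbounded vA nA.
have [r hr rle] := border_waring_rank_exists (border_waring_of_limit hf vL).
exists r => //; apply: leq_trans rle _.
have d1 : (d.+1 * d.+2 <= 2 * d.+1 ^ 2)%N by rewrite expnS expn1; nia.
by apply: leq_trans d1 _; rewrite leq_mul2l /= leq_pexp2l.
Qed.
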